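(* For the numerical solution of Scheme P-EQ (defined in the context), the following error estimate holds for $0\le n\le N$: $$\|e^{n}_\phi\|^2_{H^1}+\|e^{n}_q\|^2_{L^2}+\|e^{n}_\zeta\|^2_{L^2}\le C\,\Delta t^4 ,$$ where $C$ is a generic constant independent of $\Delta t$.
   Context: Setting. $\Omega\subset\mathbb R^2$ is open, connected and bounded with sufficiently smooth boundary, such that the Sobolev inequalities $\|u\|_{L^4}^2\le C\|u\|_{L^2}\|u\|_{H^1}$ and $\|u\|_{L^\infty}^2\le C\|u\|_{H^1}\|u\|_{H^2}$ hold. The time interval is $[0,T]$, $\Delta t=T/N$, $t_n=n\Delta t$. $\gamma_1,\gamma_2$ and $\eta>0$ are model parameters, $f(\phi)=\gamma_2\phi^2(1-\phi)^2$, and the mobility is set to $M\equiv1$. Exact problem (Allen-Cahn equation with a penalizing potential). $\phi(\mathbf x,t)$ solves $\phi_t=-\tilde\mu$ in $\Omega$ for $t>0$, $\partial\phi/\partial n=0$ on $\partial\Omega$, with given initial value $\phi(\mathbf x,0)$, where $\tilde\mu=-\gamma_1\Delta\phi+f'(\phi)+\sqrt\eta\,\zeta$ and $\zeta(t)=\sqrt\eta\big(\int_\Omega\phi(\mathbf x,t)\,d\mathbf x-\int_\Omega\phi(\mathbf x,0)\,d\mathbf x\big)$. Put $q=\sqrt{f(\phi)-\gamma_2\phi^2+C_0}$ with a constant $C_0$, and $g=\partial q/\partial\phi$, so that $f'(\phi)=2\gamma_2\phi+2qg$. Regularity assumption on the exact solution: $\phi\in L^\infty(0,T;H^2(\Omega))\cap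 L^\infty(0,T;W^{1,\infty}(\Omega))$ and $\phi_t\in L^\infty(0,T;L^\infty(\Omega))\cap L^2(0,T;H^1(\Omega))$. Notation: $a^{n+1/2}=\frac12(a^{n+1}+a^n)$ and $\overline a^{n+1/2}=\frac32a^n-\frac12a^{n-1}$; $g^n=g(\phi^n)$. Scheme P-EQ (energy quadratization, linear Crank-Nicolson, semi-discrete in time). Given the initial condition $\phi^0$, $q^0$ and $\zeta^0$ are calculated from $\phi^0$, and $\phi^1,q^1,\zeta^1$ are calculated by a first order scheme. Having computed the values at steps $n-1$ and $n$, compute those at step $n+1$ (with the homogeneous Neumann boundary condition of the model) from $$\frac{\phi^{n+1}-\phi^n}{\Delta t}-\gamma_1\Delta\phi^{n+1/2}+2\gamma_2\phi^{n+1/2}+2q^{n+1/2}\overline g^{n+1/2}+\sqrt\eta\,\zeta^{n+1/2}=0,$$ $$q^{n+1}-q^n=\overline g^{n+1/2}(\phi^{n+1}-\phi^n),\qquad \zeta^{n+1}-\zeta^n=\sqrt\eta\int_\Omega(\phi^{n+1}-\phi^n)\,d\mathbf x .$$ Truncation: substituting the exact solution into these difference equations (Taylor expansion) leaves truncation errors of order $O(\Delta t^2)$ in each of them. Errors: $e^n_\phi=\phi(t_n)-\phi^n$, $e_q^n=q(t_n)-q^n$, $e_\zeta^n=\zeta(t_n)-\zeta^n$, with exact values $\phi(t_n),q(t_n),\zeta(t_n)$; scalars are regarded as constant functions on $\Omega$ in the $L^2(\Omega)$ norm. *)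

(* Defs.v *)
From HB Require Import structures.
From mathcomp Require Import all_boot all_order all_algebra.
From mathcomp Require Import all_classical all_reals all_analysis.

Set Implicit Arguments.
Unset Strict Implicit.
Unset Printing Implicit Defensive.
Import Order.TTheory GRing.Theory Num.Theory.
Import numFieldNormedType.Exports.

Local Open Scope classical_set_scope.
Local Open Scope ring_scope.

Notation mR R := (measurableTypeR R).
Notation mR2 R := (measurableTypeR R * measurableTypeR R)%type.

Definition leb (R : realType) : {measure set (mR R) -> \bar R} :=
  @lebesgue_measure R.

Definition leb2 (R : realType) : {measure set (mR2 R) -> \bar R} :=
  (@lebesgue_measure R \x @lebesgue_measure R)%E.

Section FunctionSpaces.
Context {R : realType}.
Implicit Types (Om : set (R * R)) (u v psi : R * R -> R) (i : 'I_2).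

Definition basis i : R * R := if i == ord0 then (1, 0) else (0, 1).

Definition pd i psi : R * R -> R := fun x => 'D_(basis i) psi x.

Fixpoint classC (k : nat) psi : Prop :=
  continuous psi /\
  (if k is k'.+1 then
     forall i, (forall x, derivable psi x (basis i)) /\ classC k' (pd i psi)
   else True).

(* Om is locally the strict sublevel set of a C^1 function with nonvanishing
   gradient. *)
Definition C1_boundary Om : Prop :=
  forall x, (closure Om `\` Om) x ->
  exists rho, [/\ classC 1 rho, exists i, pd i rho x != 0
    & \forall y \near x, Om y <-> rho y < 0].

Definition test_fun Om psi : Prop :=
  (forall k, classC k psi) /\
  exists K, [/\ compact K, K `<=` Om & forall x, ~ K x -> psi x = 0].

Definition integ Om u : R := Rintegral (@leb2 R) Om u.

Definition ae_in Om (P : R * R -> Prop) : Prop :=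
  {ae @leb2 R, forall x : mR2 R, Om x -> P x}.

Definition normLp Om (p : \bar R) u : \bar R :=
  ('N[@leb2 R]_p [(EFin \o u) \_ Om])%E.

Definition inL2 Om u : Prop :=
  measurable_fun (Om : set (mR2 R)) (u : mR2 R -> mR R) /\
  (normLp Om 2%:E u < +oo)%E.

(* All functions in play are square integrable on the bounded set Om, so weak
   derivatives are taken within L^2(Om). *)
Definition weak_deriv Om i u v : Prop :=
  [/\ inL2 Om u, inL2 Om v & forall psi, test_fun Om psi ->
    integ Om (fun x => u x * pd i psi x) = - integ Om (fun x => v x * psi x)].

(* Squared norm of H^k(Om) = W^{k,2}(Om), the sum of ||D^a u||^2 over words a
   of length at most k in the two directions (k = 1: ||u||^2 + ||grad u||^2;
   k = 2: moreover the Frobenius norm of the Hessian).  The weak derivative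
   being unique a.e., each infimum is over a single a.e. class, on which the
   norm is constant; it is +oo when there is no weak derivative. *)
Fixpoint sqnormH Om (k : nat) u : \bar R :=
  (normLp Om 2%:E u ^+ 2 +
   if k is k'.+1 then
     \sum_(i < 2) ereal_inf [set sqnormH Om k' v | v in weak_deriv Om i u]
   else 0)%E.

Definition normH Om k u : \bar R := (sqnormH Om k u `^ 2^-1)%E.

Definition inH Om k u : Prop :=
  measurable_fun (Om : set (mR2 R)) (u : mR2 R -> mR R) /\
  (sqnormH Om k u < +oo)%E.

(* Norm of W^{1,oo}(Om), with the same convention for the infima. *)
Definition normW1oo Om u : \bar R :=
  maxe (normLp Om +oo%E u)
    (maxe (ereal_inf [set normLp Om +oo%E v | v in weak_deriv Om ord0 u])
          (ereal_inf [set normLp Om +oo%E v | v in weak_deriv Om ord_max u])).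

Definition weak_hess Om u (g h : 'I_2 -> R * R -> R) : Prop :=
  forall i, weak_deriv Om i u (g i) /\ weak_deriv Om i (g i) (h i).

(* The Laplacian of u in H^2(Om), determined a.e. in Om. *)
Definition lap Om u : R * R -> R :=
  xget (cst 0) [set L | exists g h,
    weak_hess Om u g h /\ L = (fun x => \sum_(i < 2) h i x)].

(* The normal derivative of u in H^2(Om) is the functional on H^1(Om)
   v |-> \int_Om (Lap u) v + (grad u).(grad v)   (generalised normal trace);
   the homogeneous Neumann condition says that it vanishes.  The integral does
   not depend on the representatives g, h, k of the weak derivatives. *)
Definition neumann0 Om u : Prop :=
  inH Om 2 u /\
  forall (g h : 'I_2 -> R * R -> R) v (k : 'I_2 -> R * R -> R),
    weak_hess Om u g h -> (forall i, weak_deriv Om i v (k i)) ->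
    integ Om (fun x => (\sum_(i < 2) h i x) * v x +
                       \sum_(i < 2) g i x * k i x) = 0.

Definition sobolev_inequalities Om : Prop :=
  exists C : R,
    (forall u, inH Om 1 u ->
      (normLp Om 4%:E u ^+ 2 <= C%:E * normLp Om 2%:E u * normH Om 1 u)%E) /\
    (forall u, inH Om 2 u ->
      (normLp Om +oo u ^+ 2 <= C%:E * normH Om 1 u * normH Om 2 u)%E).

(* f in L^p(0,T;X), where X is the function space on Om with extended norm
   nX (equal to +oo outside X). *)
Definition inLpX Om (T : R) (p : \bar R) (nX : (R * R -> R) -> \bar R)
    (f : R -> R * R -> R) : Prop :=
  measurable_fun (`[0, T] `*` Om : set (mR R * mR2 R))
    ((fun z => f z.1 z.2) : mR R * mR2 R -> mR R) /\
  ('N[@leb R]_p [(fun t => nX (f t)) \_ `[0%R, T]] < +oo)%E.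

(* ft is the time derivative of f on (0,T) and f is the (absolutely)
   continuous representative, so that f t makes sense for every t. *)
Definition time_deriv Om (T : R) (f ft : R -> R * R -> R) : Prop :=
  forall s t, 0 <= s -> s <= t -> t <= T ->
  ae_in Om (fun x =>
    f t x - f s x = Rintegral (@leb R) `[s, t] (fun tau => ft tau x)).

End FunctionSpaces.

Section Model.
Context {R : realType}.
Variables (Om : set (R * R)) (T gam1 gam2 eta C0 : R).
Implicit Types (phi phit : R -> R * R -> R).

Definition dwell (s : R) : R := gam2 * s ^+ 2 * (1 - s) ^+ 2.
Definition radicand (s : R) : R := dwell s - gam2 * s ^+ 2 + C0.
Definition qfun (s : R) : R := Num.sqrt (radicand s).
Definition gfun : R -> R := derive1 qfun.

Definition zeta phi (t : R) : R :=
  Num.sqrt eta * (integ Om (phi t) - integ Om (phi 0)).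

Definition mu_tilde phi (t : R) (x : R * R) : R :=
  - gam1 * lap Om (phi t) x + derive1 dwell (phi t x) + Num.sqrt eta * zeta phi t.

Record exact_solution phi phit : Prop := {
  exact_time_deriv : time_deriv Om T phi phit;
  exact_equation : {ae @leb R, forall t : mR R, 0 < t < T ->
    ae_in Om (fun x => phit t x = - mu_tilde phi t x)};
  exact_neumann : forall t, 0 < t <= T -> neumann0 Om (phi t) }.

Record regularity phi phit : Prop := {
  phi_H2 : inLpX Om T +oo (normH Om 2) phi;
  phi_W1oo : inLpX Om T +oo (normW1oo Om) phi;
  phit_Loo : inLpX Om T +oo (normLp Om +oo) phit;
  phit_H1 : inLpX Om T 2%:E (normH Om 1) phit }.

(* Values of (phi, q, zeta) at one time level. *)
Record state := State {
  sphi : R * R -> R;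
  sq : R * R -> R;
  szeta : R }.

Definition exact_state phi (t : R) : state :=
  State (phi t) (fun x => qfun (phi t x)) (zeta phi t).

Definition init_state (phi0 : R * R -> R) : state :=
  State phi0 (fun x => qfun (phi0 x)) 0.

Definition sqerr (a b : state) : \bar R :=
  (sqnormH Om 1 (fun x => (sphi a x - sphi b x)%R) +
   normLp Om 2%:E (fun x => (sq a x - sq b x)%R) ^+ 2 +
   normLp Om 2%:E (cst (szeta a - szeta b)%R) ^+ 2)%E.

Definition gbar (U : nat -> state) (n : nat) (x : R * R) : R :=
  3 / 2 * gfun (sphi (U n) x) - 1 / 2 * gfun (sphi (U n.-1) x).

(* Left-hand sides minus right-hand sides of the three equations of the scheme
   taking the levels n-1 and n to the level n+1 (n >= 1). *)
Definition res_phi (dt : R) (U : nat -> state) (n : nat) (x : R * R) : R :=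
  (sphi (U n.+1) x - sphi (U n) x) / dt
  - gam1 * lap Om (fun y => (sphi (U n.+1) y + sphi (U n) y) / 2) x
  + 2 * gam2 * ((sphi (U n.+1) x + sphi (U n) x) / 2)
  + 2 * ((sq (U n.+1) x + sq (U n) x) / 2) * gbar U n x
  + Num.sqrt eta * ((szeta (U n.+1) + szeta (U n)) / 2).

Definition res_q (U : nat -> state) (n : nat) (x : R * R) : R :=
  sq (U n.+1) x - sq (U n) x
  - gbar U n x * (sphi (U n.+1) x - sphi (U n) x).

Definition res_zeta (U : nat -> state) (n : nat) : R :=
  szeta (U n.+1) - szeta (U n)
  - Num.sqrt eta * integ Om (fun x => sphi (U n.+1) x - sphi (U n) x).

Record peq_solution (start : R -> state -> state) (phi0 : R * R -> R)
    (N : nat) (U : nat -> state) : Prop := {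
  peq_init : U 0%N = init_state phi0;
  peq_first : U 1%N = start (T / N%:R) (U 0%N);
  peq_neumann : forall n, (1 <= n <= N)%N -> neumann0 Om (sphi (U n));
  peq_sq : forall n, (1 <= n <= N)%N -> inL2 Om (sq (U n));
  peq_step : forall n, (1 <= n < N)%N ->
    [/\ ae_in Om (fun x => res_phi (T / N%:R) U n x = 0),
        ae_in Om (fun x => res_q U n x = 0)
      & res_zeta U n = 0] }.

(* A one-step method of first order: its local error, i.e. the error after one
   step of size dt started from exact data, is O(dt^2). *)
Definition first_order_scheme phi (start : R -> state -> state) : Prop :=
  exists K : R, forall t dt, 0 <= t -> 0 < dt -> t + dt <= T ->
  (sqerr (exact_state phi (t + dt)) (start dt (exact_state phi t))
     <= ((K * dt ^+ 2) ^+ 2)%:E)%E.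

(* Truncation errors O(dt^2) in L^2(Om), uniformly in n.  The equations for q
   and zeta are not divided by dt, whence the extra factor dt. *)
Definition second_order_truncation phi : Prop :=
  exists K : R, forall N n : nat, (1 <= n < N)%N ->
  let dt := T / N%:R in
  let V := fun k : nat => exact_state phi (k%:R * dt) in
  [/\ (normLp Om 2%:E (res_phi dt V n) <= (K * dt ^+ 2)%:E)%E,
      (normLp Om 2%:E (res_q V n) <= (dt * (K * dt ^+ 2))%:E)%E
    & (normLp Om 2%:E (cst (res_zeta V n)) <= (dt * (K * dt ^+ 2))%:E)%E].

End Model.

(* Main.v *)
Require Import Defs.
From HB Require Import structures.
From mathcomp Require Import all_boot all_order all_algebra.
From mathcomp Require Import all_classical all_reals all_analysis.
From mathcomp Require Import measurable_realfun ess_sup_inf ring lra.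

Set Implicit Arguments.
Unset Strict Implicit.
Unset Printing Implicit Defensive.
Import Order.TTheory GRing.Theory Num.Theory.
Import numFieldNormedType.Exports.

Local Open Scope classical_set_scope.
Local Open Scope ring_scope.

(** Why the estimate holds.

    Subtract the scheme from the difference equations satisfied by the exact
    solution and test the resulting equation for the phase-field error e with
    the increment e^{n+1} - e^n.  The quadratization makes the scheme linear in
    the new level, and its effect on the errors is an exact cancellation: the
    term with the numerical gbar in the phi-equation, tested with the
    increment, equals what the q-equation contributes to the increment of
    |e_q|^2, so that only the exact solution has to be bounded
    (pointwise_energy).  The zeta-equation absorbs the nonlocal term in the same
    way.
    What remains on the right is
    - the truncation errors,
    - the products of the difference of the two gbar with the exact q or with
      the increment of the exact phi.
    The second group is controlled because g is globally Lipschitz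
    (gfun_lipschitz), the exact q is bounded (exact_q_Loo) and the increment
    of the exact phi is O(dt) (exact_lipschitz_in_time).

    The bounds on the exact solution must hold at every grid time, whereas
    membership in L^oo(0,T;X) only speaks of almost every time.  They follow
    from two facts: the exact phi is Lipschitz in time with values in L^oo,
    because its time derivative is bounded (Fubini exchanges the two almost
    everywhere quantifiers), and phi(T) is in H^2, hence bounded by the Sobolev
    inequality.

    The Neumann condition turns the Laplacian of the averaged error against the
    increment into the increment of the squared gradient norm
    (neumann_laplacian_energy).  Weak gradients are carried along as explicit
    representatives: the weak gradient of e^{n+1} is defined from that of e^n
    and from the gradients attached to the averaged functions.  The identity
    then holds for these representatives by pure algebra, and the H^1 norm,
    being an infimum over representatives, is at most the norm they give.

    This yields, for the energy
      gam1/2 |grad e_phi|^2 + gam2 |e_phi|^2 + |e_q|^2 + e_zeta^2 / 2,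
    an implicit discrete Gronwall inequality with local defect O(dt^5).  Since
    dt <= T, the weights in the Young inequalities can be chosen proportional
    to dt / T, so that the implicit part is absorbed for every dt
    (implicit_step_growth). *)

(** * The quadratized potential *)

Section Quadratization.
Context {R : realType} (gam2 C0 : R).
Hypothesis gam2_gt0 : 0 < gam2.
Hypothesis C0_large : forall s, 0 < radicand gam2 C0 s.

Let P := radicand gam2 C0.
Let P' (s : R) := gam2 * (4 * s ^+ 3 - 6 * s ^+ 2).
Let q := qfun gam2 C0.

Let PE s : P s = gam2 * (s ^+ 4 - 2 * s ^+ 3) + C0.
Proof. rewrite /P /radicand /dwell; ring. Qed.

(** The radicand is a quartic with positive leading coefficient and positive
    minimum, so its square root grows at least like 1 + s^2.  This lower bound
    is what keeps the quotients in g and its derivative bounded. *)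
Lemma radicand_coercive : exists2 m : R, 0 < m &
  forall s, (m * (1 + s ^+ 2)) ^+ 2 <= P s.
Proof.
(* The quartic s^4 - 2 s^3 attains its minimum -27/16 at s = 3/2. *)
have d0 := C0_large (3 / 2).
set d := radicand gam2 C0 (3 / 2) in d0.
have dE : C0 = d + 27 / 16 * gam2 by rewrite /d -/P PE; field.
(* 289 = (1 + 4^2)^2: the minimum d decides for |s| <= 4, the leading term beyond. *)
pose k : R := Num.min d gam2 / 289.
have k0 : 0 < k by rewrite divr_gt0 ?lt_min ?d0 ?gam2_gt0// ltr0n.
have kd : 289 * k <= d by rewrite /k mulrC divfK ?pnatr_eq0// ge_min lexx.
have kg : 289 * k <= gam2 by rewrite /k mulrC divfK ?pnatr_eq0// ge_min lexx orbT.
clearbody k d; exists (Num.sqrt k); first by rewrite sqrtr_gt0.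
move=> s; rewrite exprMn sqr_sqrtr; last exact: ltW.
rewrite PE; have s2 := sqr_ge0 s.
have [s16|/ltW s16] := leP (s ^+ 2) 16.
- have -> : gam2 * (s ^+ 4 - 2 * s ^+ 3) + C0 =
    gam2 * ((s - 3 / 2) ^+ 2 * ((s + 1 / 2) ^+ 2 + 1 / 2)) + d.
    by rewrite dE; field.
  have h1 : 0 <= gam2 * ((s - 3 / 2) ^+ 2 * ((s + 1 / 2) ^+ 2 + 1 / 2)).
    rewrite mulr_ge0 ?(ltW gam2_gt0)// mulr_ge0 ?sqr_ge0//.
    by rewrite addr_ge0 ?sqr_ge0//.
  have h2 : (1 + s ^+ 2) ^+ 2 <= 289.
    have : 0 <= (16 - s ^+ 2) * (18 + s ^+ 2).
      by rewrite mulr_ge0 ?subr_ge0 ?addr_ge0.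
    lra.
  have := ler_wpM2l (ltW k0) h2; lra.
- have s4 : 4 * s <= s ^+ 2.
    have : 0 <= (s - 4) ^+ 2 by exact: sqr_ge0.
    have -> : (s - 4) ^+ 2 = s ^+ 2 - 8 * s + 16 by ring.
    lra.
  have h1 : s ^+ 4 / 2 <= s ^+ 4 - 2 * s ^+ 3.
    suff : 0 <= s ^+ 2 * (s ^+ 2 - 4 * s) by nra.
    by rewrite mulr_ge0// subr_ge0.
  have h2 : (1 + s ^+ 2) ^+ 2 <= 4 * s ^+ 4 by nra.
  have h3 := ler_wpM2l (ltW k0) h2.
  have h4 := ler_wpM2l (ltW gam2_gt0) h1.
  have s40 : 0 <= s ^+ 4 by rewrite -[4%N]/(2 * 2)%N exprM sqr_ge0.
  have h5 := ler_wpM2r s40 kg.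
  have : 0 <= C0 by rewrite dE; nra.
  nra.
Qed.

Let q_gt0 s : 0 < q s.
Proof. by rewrite /q /qfun sqrtr_gt0. Qed.

Let is_derive_P (s : R) : is_derive s 1 P (P' s).
Proof.
rewrite (_ : P = (fun s => gam2 * (s ^+ 4 - 2 * s ^+ 3) + C0)); last exact/funext.
apply: is_derive_eq; rewrite /P' /= /GRing.scale /=; ring.
Qed.

Let is_derive_q (s : R) : is_derive s 1 q (P' s / (2 * q s)).
Proof.
have h := @is_derive1_sqrt _ (P s) (C0_large s).
by have := @is_derive1_comp _ Num.sqrt P s _ _ h (is_derive_P s);
  rewrite /q /qfun mulrC.
Qed.

Let gfunE s : gfun gam2 C0 s = P' s / (2 * q s).
Proof. by rewrite /gfun derive1E; exact: derive_val. Qed.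

(** The derivative of g, that is q'' with q' = P' / (2 q) substituted. *)
Let dg (s : R) : R := gam2 * (12 * s ^+ 2 - 12 * s) / (2 * q s) - (P' s) ^+ 2 / (4 * q s ^+ 3).

Let is_derive_g (s : R) : is_derive s 1 (gfun gam2 C0) (dg s).
Proof.
rewrite (_ : gfun gam2 C0 = (fun s => P' s * (2 * q s)^-1)); last first.
  by apply/funext => t; exact: gfunE.
have dP' : is_derive s 1 P' (gam2 * (12 * s ^+ 2 - 12 * s)).
  by apply: is_derive_eq; rewrite /GRing.scale /=; ring.
have q0 : q s != 0 by rewrite gt_eqF.
have d2q : is_derive s 1 (fun s => (2 * q s)) (P' s / q s).
  have dq := is_derive_q s.
  change (is_derive s 1 (2%:R \*: q) (P' s / q s)).
  by apply: is_derive_eq; rewrite /GRing.scale /=; field; rewrite q0.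
have q20 : 2 * q s != 0 by rewrite mulf_neq0// pnatr_eq0.
have dV := @is_deriveV _ (fun s => 2 * q s) s _ 1 q20 d2q.
change (is_derive s 1 (P' * (fun s => (2 * q s)^-1))%R (dg s)).
apply: is_derive_eq; rewrite /GRing.scale /= /dg; field.
by rewrite q0.
Qed.

Let dg_bounded : exists2 L : R, 0 <= L & forall s, `|dg s| <= L.
Proof.
have [m m0 mP] := radicand_coercive.
have qm s : m * (1 + s ^+ 2) <= q s.
  rewrite /q /qfun.
  rewrite -[leLHS]ger0_norm ?mulr_ge0 ?(ltW m0) ?addr_ge0 ?sqr_ge0//.
  by rewrite -sqrtr_sqr ler_sqrt ?mP// (ltW (C0_large _)).
exists (9 * gam2 / m + 15 * gam2 ^+ 2 / m ^+ 3).
  by rewrite addr_ge0// mulr_ge0 ?invr_ge0 ?exprn_ge0 ?(ltW m0)// mulr_ge0// ?exprn_ge0 ?ltW.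
move=> s; have s2 := sqr_ge0 s; set t := 1 + s ^+ 2.
have t0 : 0 < t by rewrite /t; lra.
have mt0 : 0 < m * t by rewrite mulr_gt0.
rewrite /dg; apply: le_trans (ler_normB _ _) _; apply: lerD.
  rewrite normrM normfV (@gtr0_norm _ (2 * q s)) ?mulr_gt0//.
  rewrite ler_pdivrMr ?mulr_gt0//.
  rewrite normrM (gtr0_norm gam2_gt0).
  apply: (@le_trans _ _ (gam2 * (18 * t))).
    rewrite ler_wpM2l ?(ltW gam2_gt0)// ler_norml /t.
    have := sqr_ge0 (s + 1); have := sqr_ge0 (s - 1); rewrite !(expr2 (_ + _)) => *.
    by apply/andP; split; nra.
  apply: (@le_trans _ _ (9 * gam2 / m * (2 * (m * t)))).
    by rewrite le_eqVlt; apply/orP; left; apply/eqP; field; rewrite gt_eqF.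
  rewrite ler_wpM2l ?ler_wpM2l ?qm// ?divr_ge0 ?mulr_ge0 ?ltW//.
rewrite ger0_norm; last by rewrite divr_ge0 ?sqr_ge0 ?mulr_ge0 ?exprn_ge0 ?(ltW (q_gt0 _)).
rewrite ler_pdivrMr ?mulr_gt0 ?exprn_gt0//.
apply: (@le_trans _ _ (60 * gam2 ^+ 2 * t ^+ 3)).
  have -> : P' s ^+ 2 = gam2 ^+ 2 * (s ^+ 2 * s ^+ 2 * (4 * s - 6) ^+ 2).
    rewrite /P'; ring.
  have -> : 60 * gam2 ^+ 2 * t ^+ 3 = gam2 ^+ 2 * (t * t * (60 * t)) by ring.
  rewrite ler_wpM2l ?sqr_ge0//.
  have st : s ^+ 2 <= t by rewrite /t; lra.
  have h6 : (4 * s - 6) ^+ 2 <= 60 * t by have := sqr_ge0 (s + 1); rewrite /t; nra.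
  have h4 : s ^+ 2 * s ^+ 2 <= t * t by exact: ler_pM.
  by apply: ler_pM => //; [exact: mulr_ge0 | exact: sqr_ge0].
apply: (@le_trans _ _ (15 * gam2 ^+ 2 / m ^+ 3 * (4 * (m * t) ^+ 3))).
  rewrite exprMn le_eqVlt; apply/orP; left; apply/eqP; field; rewrite gt_eqF//.
rewrite ler_wpM2l ?ler_wpM2l//.
  by rewrite divr_ge0 ?mulr_ge0 ?exprn_ge0 ?ltW.
by rewrite lerXn2r ?nnegrE ?qm ?ltW.
Qed.

(** Although g grows linearly at infinity, its derivative is bounded: numerator
    and denominator in each of its two terms have the same degree.  The
    global Lipschitz constant controls the difference of the two gbar whatever
    the size of the numerical solution. *)
Lemma gfun_lipschitz : exists2 L : R, 0 <= L &
  forall x y, `|gfun gam2 C0 x - gfun gam2 C0 y| <= L * `|x - y|.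
Proof.
have [L L0 dgL] := dg_bounded; exists L => // x y.
wlog xy : x y / y <= x.
  move=> h; have [/h//|/ltW/h] := leP y x.
  by rewrite distrC (distrC y).
have cg : {within `[y, x], continuous gfun gam2 C0}.
  apply: continuous_subspaceT => z; apply: differentiable_continuous.
  by apply/derivable1_diffP; have [] := is_derive_g z.
have [c _ ->] := MVT_segment xy (fun z _ => is_derive_g z) cg.
by rewrite normrM ler_wpM2r.
Qed.

Lemma continuous_gfun : continuous (gfun gam2 C0).
Proof.
move=> z; apply: differentiable_continuous.
by apply/derivable1_diffP; have [] := is_derive_g z.
Qed.

Lemma continuous_qfun : continuous (qfun gam2 C0).
Proof.
move=> z; apply: differentiable_continuous.
by apply/derivable1_diffP; have [] := is_derive_q z.
Qed.

Lemma qfun_bounded (B : R) : exists2 Q : R, 0 <= Q &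
  forall s, `|s| <= B -> `|qfun gam2 C0 s| <= Q.
Proof.
have [B0|B0] := ltP B 0.
  by exists 0 => // s sB; have := lt_le_trans B0 (normr_ge0 s); lra.
exists (1 + (gam2 * (B ^+ 4 + 2 * B ^+ 3) + `|C0|)) => [|s sB].
  by rewrite !addr_ge0// mulr_ge0 ?(ltW gam2_gt0)// addr_ge0 ?mulr_ge0 ?exprn_ge0.
have sX k : `|s ^+ k| <= B ^+ k by rewrite normrX lerXn2r ?nnegrE.
have PB : P s <= gam2 * (B ^+ 4 + 2 * B ^+ 3) + `|C0|.
  rewrite PE lerD ?ler_norm// ler_wpM2l ?(ltW gam2_gt0)//.
  have := sX 3%N; rewrite ler_norml => /andP[h _].
  have := le_trans (ler_norm _) (sX 4%N); lra.
rewrite ger0_norm; last exact: ltW (q_gt0 s).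
have : q s ^+ 2 = P s by rewrite sqr_sqrtr// ltW// C0_large.
have := sqr_ge0 (q s - 1); rewrite -/q; have := q_gt0 s.
rewrite sqrrB1 => *; nra.
Qed.

End Quadratization.

(** * Square-integrable functions on a set of finite measure *)

Section SquareIntegrable.
Context d {T : measurableType d} {R : realType}.
Variable mu : {measure set T -> \bar R}.
Variables (D : set T) (mD : measurable D).
Implicit Types (u v w : T -> R) (f : T -> \bar R).

Definition sqint u : Prop :=
  measurable_fun D u /\ mu.-integrable D (fun x => (u x ^+ 2)%:E).

(** The bridge from the extended-valued norm, in which the statement is
    phrased, to a Lebesgue integral; both sides may be infinite. *)
Lemma Lnorm2_sqr u :
  ('N[mu]_2%:E[(EFin \o u) \_ D] ^+ 2 = \int[mu]_(x in D) (u x ^+ 2)%:E)%E.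
Proof.
set n := Lnorm _ _ _.
have n0 : (0 <= n)%E by exact: Lnorm_ge0.
have -> : (n ^+ 2 = n `^ 2%:R)%E.
  case: n n0 => [r r0||//].
    by rewrite poweR_EFin powR_mulrn// -EFin_expe.
  by rewrite poweRyr// ?pnatr_eq0// expe2 mulyy.
rewrite poweR_Lnorm ?pnatr_eq0// [RHS]integral_mkcond; apply: eq_integral => x _.
rewrite patchE [in RHS]patchE; case: ifPn => _ /=.
  by rewrite -[X in (_ `^ X)%R]/(2%:R) powR_mulrn// real_normK// num_real.
by rewrite normr0 powR0.
Qed.

Lemma integrable_sqrP u : measurable_fun D u ->
  mu.-integrable D (fun x => (u x ^+ 2)%:E) <->
  ('N[mu]_2%:E[(EFin \o u) \_ D] < +oo)%E.
Proof.
move=> mu_; set n := Lnorm _ _ _.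
have -> : (n < +oo)%E <-> (\int[mu]_(x in D) (u x ^+ 2)%:E < +oo)%E.
  rewrite -Lnorm2_sqr -/n; have : (0 <= n)%E by exact: Lnorm_ge0.
  case: n => [r r0||//]; first by rewrite -EFin_expe !ltry.
  by rewrite expe2 mulyy.
split=> [/integrable_lty h|h].
  exact: h.
apply/integrableP; split; first exact/measurable_EFinP/measurable_funX.
by under eq_integral => x _ do rewrite gee0_abs ?lee_fin ?sqr_ge0//.
Qed.

Lemma Lnorm2_sqr_fin u : sqint u ->
  ('N[mu]_2%:E[(EFin \o u) \_ D] ^+ 2 = (\int[mu]_(x in D) u x ^+ 2)%R%:E)%E.
Proof.
by move=> [mu_ iu]; rewrite Lnorm2_sqr /Rintegral fineK//; exact: integrable_fin_num.
Qed.

Lemma ae_le_integrable f g : measurable_fun D f ->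
  {ae mu, forall x, D x -> (`|f x| <= `|g x|)%E} ->
  mu.-integrable D g -> mu.-integrable D f.
Proof.
move=> mf fg /integrableP[mg goo]; apply/integrableP; split => //.
by apply: le_lt_trans goo; apply: ae_ge0_le_integral => //; exact: measurableT_comp.
Qed.

Lemma ae_le_sqint u v : measurable_fun D u ->
  {ae mu, forall x, D x -> `|u x| <= `|v x|} -> sqint v -> sqint u.
Proof.
move=> mu_ uv [mv iv]; split=> //.
apply: ae_le_integrable iv; first exact/measurable_EFinP/measurable_funX.
apply: filterS uv => x /[apply] uv.
by rewrite /= lee_fin !normrX lerXn2r ?nnegrE.
Qed.

Lemma integrable_mul u v : sqint u -> sqint v ->
  mu.-integrable D (fun x => (u x * v x)%:E).
Proof.
move=> [mu_ iu] [mv iv].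
apply: (le_integrable mD _ _ (integrableD mD iu iv)).
  exact/measurable_EFinP/measurable_funM.
move=> x _ /=; rewrite lee_fin (ger0_norm (addr_ge0 _ _)) ?sqr_ge0//.
rewrite normrM -(real_normK (num_real (u x))) -(real_normK (num_real (v x))).
have := sqr_ge0 (`|u x| - `|v x|); rewrite sqrrB.
have := sqr_ge0 `|u x|; have := sqr_ge0 `|v x|; lra.
Qed.

Lemma sqintZ (k : R) u : sqint u -> sqint (fun x => k * u x).
Proof.
move=> [mu_ iu]; split; first exact: measurable_funM.
under eq_fun do rewrite exprMn EFinM.
exact: integrableZl.
Qed.

Lemma sqintD u v : sqint u -> sqint v -> sqint (fun x => u x + v x).
Proof.
move=> su sv; have [mu_ iu] := su; have [mv iv] := sv; split.
  exact: measurable_funD.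
have h := integrableZl mD 2 (integrable_mul su sv).
have := integrableD mD (integrableD mD iu h) iv.
by apply: eq_integrable => // x _ /=; rewrite -EFinM -!EFinD sqrrD mulr_natl.
Qed.

Lemma sqintB u v : sqint u -> sqint v -> sqint (fun x => u x - v x).
Proof.
move=> su sv.
have := sqintD su (sqintZ (-1) sv).
by congr sqint; apply/funext => x; rewrite mulN1r.
Qed.

Hypothesis muD : (mu D < +oo)%E.

Lemma sqint_cst (k : R) : sqint (cst k).
Proof.
split; first exact: measurable_cst.
apply/integrableP; split; first exact: (measurable_cst (k ^+ 2)%:E).
rewrite (_ : (fun x => _) = cst `|(k ^+ 2)%:E|%E)// integral_cst//.
by rewrite lte_mul_pinfty.
Qed.

Lemma integrable_sqint u : sqint u -> mu.-integrable D (EFin \o u).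
Proof.
move=> su; have := integrable_mul su (sqint_cst 1).
by apply: eq_integrable => // x _ /=; rewrite mulr1.
Qed.

Lemma ae_bounded_sqint u (B : R) : measurable_fun D u ->
  {ae mu, forall x, D x -> `|u x| <= B} -> sqint u.
Proof.
move=> mu_ uB; apply: (@ae_le_sqint _ (cst B)) => //; last exact: sqint_cst.
apply: filterS uB => x /[apply] h; apply: le_trans h _; exact: ler_norm.
Qed.

(** Monotonicity from an almost everywhere inequality: the nonnegative
    difference agrees almost everywhere with its absolute value. *)
Lemma ae_le_Rintegral u v :
  mu.-integrable D (EFin \o u) -> mu.-integrable D (EFin \o v) ->
  {ae mu, forall x, D x -> u x <= v x} ->
  \int[mu]_(x in D) u x <= \int[mu]_(x in D) v x.
Proof.
move=> iu iv uv; rewrite -subr_ge0 -RintegralB//.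
have iw : mu.-integrable D (fun x => (v x - u x)%:E).
  by have := integrableB mD iv iu; apply: eq_integrable.
rewrite /Rintegral fine_ge0//.
rewrite (ae_eq_integral (fun x => `|v x - u x|%:E)) //.
- by apply: integral_ge0 => x _; rewrite lee_fin.
- exact: measurable_int iw.
- by apply/measurable_EFinP/measurableT_comp => //; apply/measurable_EFinP; exact: measurable_int iw.
- by apply: filterS uv => x /[apply] h; rewrite ger0_norm// subr_ge0.
Qed.

End SquareIntegrable.

Lemma Lnormy_ae_bounded d (T : measurableType d) (R : realType)
    (mu : {measure set T -> \bar R}) (f : T -> \bar R) :
  ('N[mu]_+oo[f] < +oo)%E ->
  exists2 M : R, 0 <= M & {ae mu, forall x, (`|f x| <= M%:E)%E}.
Proof.
rewrite unlock; case: ifPn => [mu0 foo|].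
  have f0 : (0 <= ess_sup mu (abse \o f))%E.
    by apply: ess_sup_gee => //; apply: aeW => x /=.
  exists (fine (ess_sup mu (abse \o f))); first exact: fine_ge0.
  rewrite fineK ?ge0_fin_numE//.
  exact: (ess_sup_ge mu (abse \o f)).
rewrite -leNgt => muT _; exists 0 => //.
have /= muT0 : mu setT = 0%E by apply/eqP; rewrite eq_le muT measure_ge0.
by exists setT; split.
Qed.
(** * Measurability and measure of plane domains *)

Section PlaneMeasure.
Context {R : realType}.

(** The product sigma-algebra contains the open sets of the plane since an open
    set is the countable union of the rational rectangles that it contains. *)
Lemma open_measurable_plane (Om : set (R * R)) :
  open Om -> measurable (Om : set (mR2 R)).
Proof.
move=> oOm.
pose I := (rat * rat * (rat * rat))%type.
pose rect (i : I) : set (mR2 R) :=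
  `]ratr i.1.1, ratr i.1.2[%classic `*` `]ratr i.2.1, ratr i.2.2[%classic.
pose F (i : I) : set (mR2 R) := [set z | rect i z /\ rect i `<=` Om].
have -> : Om = \bigcup_i F i.
  apply/seteqP; split => [[x y] Oxy|z [i _ [zi iO]]]; last exact: iO.
  have /nbhs_ballP[e /= e0 eO] : nbhs (x, y) Om by exact: open_nbhs_nbhs.
  have mid (z : R) : exists p : rat * rat, [/\ z - e < ratr p.1, ratr p.1 < z,
      z < ratr p.2 & ratr p.2 < z + e].
    have /rat_in_itvoo[a] : z - e < z by rewrite ltrBlDr ltrDl.
    rewrite in_itv/= => /andP[a1 a2].
    have /rat_in_itvoo[b] : z < z + e by rewrite ltrDl.
    by rewrite in_itv/= => /andP[b1 b2]; exists (a, b).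
  have [p [p1 p2 p3 p4]] := mid x; have [r [r1 r2 r3 r4]] := mid y.
  exists (p, r) => //; split; first by rewrite /rect /= !in_itv/= p2 p3 r2 r3.
  move=> [x' y'] [] /=; rewrite !in_itv/= => /andP[h1 h2] /andP[h3 h4].
  apply: eO; split; rewrite /ball/= ltr_norml; apply/andP; split; lra.
apply: countable_bigcupT_measurable; first exact: countableP.
move=> i; have [iO|iO] := pselect (rect i `<=` Om).
  rewrite (_ : F i = rect i); last by apply/seteqP; split => [z []//|z]; split.
  by apply: measurableX; exact: measurable_itv.
rewrite (_ : F i = set0); first exact: measurable0.
by apply/seteqP; split => [z []//|z].
Qed.

Let square (M : R) : set (mR2 R) := `[- M, M]%classic `*` `[- M, M]%classic.

Let measurable_square M : measurable (square M).
Proof. by apply: measurableX; exact: measurable_itv. Qed.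

Let leb2_square M : (@leb2 R (square M) < +oo)%E.
Proof.
rewrite [leb2 R _]product_measure1E; [|exact: measurable_itv..].
rewrite /= lebesgue_measure_itv/=; case: ifPn => _; last by rewrite mul0e ltry.
by rewrite -EFinD -EFinM ltry.
Qed.

Let mem_square M (z : R * R) : square M z <-> `|z| <= M.
Proof.
case: z => x y; rewrite prod_normE/= ge_max !ler_norml /square/= !in_itv/=.
by split=> [[-> ->]//|/andP[]].
Qed.

Lemma bounded_finite_measure_plane (Om : set (R * R)) :
  open Om -> bounded_set Om -> (@leb2 R Om < +oo)%E.
Proof.
move=> oOm [m [_ /(_ (m + 1))]]; rewrite ltrDl ltr01 => /(_ isT) OmM.
apply: le_lt_trans (leb2_square (m + 1)); apply: le_measure.
- by rewrite inE; exact: open_measurable_plane.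
- by rewrite inE.
- by move=> z /OmM /= zm; apply/mem_square.
Qed.

Lemma leb2_sigma_finite : sigma_finite setT (@leb2 R).
Proof.
exists (fun n : nat => square n%:R) => [|n].
  apply/seteqP; split=> // z _; exists (Num.truncn `|z|).+1 => //.
  by apply/mem_square/ltW/truncnS_gt.
by split; [exact: measurable_square | exact: leb2_square].
Qed.

End PlaneMeasure.

(** The plane measure repackaged with its sigma-finiteness, in the form in
    which Tonelli's theorem consumes it. *)
Definition plane_measure (R : realType) : set (mR2 R) -> \bar R := @leb2 R.

HB.instance Definition _ (R : realType) := Measure.on (@plane_measure R).
HB.instance Definition _ (R : realType) :=
  Measure_isSigmaFinite.Build _ _ _ (@plane_measure R) (@leb2_sigma_finite R).

Section NullSections.
Context d1 d2 (T1 : measurableType d1) (T2 : measurableType d2) (R : realType).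
Variable m1 : {sigma_finite_measure set T1 -> \bar R}.
Variable m2 : {sigma_finite_measure set T2 -> \bar R}.

(** Both quantifications say that the set has product measure zero, by
    Tonelli's theorem. *)
Lemma ae_section_swap (E : set (T1 * T2)) : measurable E ->
  {ae m1, forall x, {ae m2, forall y, ~ E (x, y)}} ->
  {ae m2, forall y, {ae m1, forall x, ~ E (x, y)}}.
Proof.
move=> mE aeE.
have := @indic_fubini_tonelli _ _ _ _ _ m1 m2 _ mE.
rewrite indic_fubini_tonelli_FE// indic_fubini_tonelli_GE//.
rewrite (ae_eq_integral (cst 0%E))//; last 2 first.
- exact: measurable_fun_xsection.
- apply: filterS aeE => x [N [mN N0 EN]] _ /=.
  apply: (subset_measure0 _ mN) => //; first exact: measurable_xsection.
  by move=> y; rewrite /xsection/= inE => Exy; apply: EN => /=; exact.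
rewrite integral0 => /esym h.
have : (\int[m2]_x `|(m1 \o ysection E) x| = 0)%E.
  by rewrite -[RHS]h; apply: eq_integral => y _; rewrite gee0_abs.
move/ae_eq_integral_abs => /(_ measurableT (measurable_fun_ysection _ mE)).
apply: filterS => y /(_ I) /= y0.
exists (ysection E y); split => //; first exact: measurable_ysection.
by move=> x /= /contrapT Exy; rewrite /ysection/= inE.
Qed.

End NullSections.

(** * Weak derivatives, the weak Laplacian and the Neumann condition *)

Section WeakDerivatives.
Context {R : realType} (Om : set (R * R)).
Hypothesis Om_open : open Om.
Hypothesis Om_bounded : bounded_set Om.
Implicit Types (u v psi : R * R -> R) (i : 'I_2).

Local Notation L2 := (sqint (@leb2 R) (Om : set (mR2 R))).
Local Notation intble := ((@leb2 R).-integrable (Om : set (mR2 R))).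

Let mOm : measurable (Om : set (mR2 R)).
Proof. exact: open_measurable_plane. Qed.

Let muOm : (@leb2 R Om < +oo)%E.
Proof. exact: bounded_finite_measure_plane. Qed.

Lemma inL2P u : inL2 Om u <-> L2 u.
Proof.
by split=> -[mu_ h]; split=> //; exact/(integrable_sqrP (@leb2 R) mOm mu_).
Qed.

Lemma normL2_sqr u : L2 u -> (normLp Om 2%:E u ^+ 2 = (integ Om (fun x => u x ^+ 2))%:E)%E.
Proof. by move=> u2; rewrite /normLp Lnorm2_sqr_fin. Qed.

(** A bounded domain lies in a compact square, on which a continuous function
    is bounded.  This makes the integrals against test functions and their
    derivatives finite, hence additive. *)
Lemma continuous_sqint (f : R * R -> R) : continuous f -> L2 f.
Proof.
move=> cf.
have mf : measurable_fun (Om : set (mR2 R)) (f : mR2 R -> mR R).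
  apply: (measurability _ (RGenOpens.measurableE R)).
  move=> _ [_ [a [b ->]] <-]; apply: measurableI => //.
  apply: open_measurable_plane; move/continuousP : cf; apply.
  exact: interval_open.
have [M OmM] : exists M, forall x, Om x -> `|x| <= M.
  have [m [_ /(_ (m + 1))]] := Om_bounded; rewrite ltrDl ltr01 => /(_ isT) h.
  by exists (m + 1).
have cI := @segment_compact R (- M) M.
have /compact_bounded[m [_ /(_ (m + 1))]] :=
  continuous_compact (continuous_subspaceT cf) (compact_setX cI cI).
rewrite ltrDl ltr01 => /(_ isT) h.
apply: (ae_bounded_sqint mOm muOm mf (B := m + 1)).
apply: aeW => x /OmM; rewrite prod_normE/= ge_max => /andP[x1 x2]; apply: h.
by exists x => //; split; rewrite /= in_itv/= -ler_norml.
Qed.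

Lemma test_fun_sqint psi i : test_fun Om psi -> L2 psi /\ L2 (pd i psi).
Proof.
move=> [sm _]; have [cpsi /(_ i)[_ [cpd _]]] := sm 1%N.
by split; exact: continuous_sqint.
Qed.

Lemma integ_comb (a b : R) f g : intble (EFin \o f) -> intble (EFin \o g) ->
  integ Om (fun x => a * f x + b * g x) = a * integ Om f + b * integ Om g.
Proof.
move=> If Ig; rewrite /integ RintegralD//.
- by rewrite !RintegralZl.
- by have := integrableZl mOm a If; apply: eq_integrable.
- by have := integrableZl mOm b Ig; apply: eq_integrable.
Qed.

Lemma weak_deriv_comb (a b : R) i u1 u2 v1 v2 :
  weak_deriv Om i u1 v1 -> weak_deriv Om i u2 v2 ->
  weak_deriv Om i (fun x => a * u1 x + b * u2 x) (fun x => a * v1 x + b * v2 x).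
Proof.
move=> [/inL2P Lu1 /inL2P Lv1 h1] [/inL2P Lu2 /inL2P Lv2 h2].
split; try by apply/inL2P/sqintD => //; apply: sqintZ.
move=> psi tpsi; have [Lp Ldp] := test_fun_sqint i tpsi.
transitivity (a * integ Om (fun x => u1 x * pd i psi x) +
              b * integ Om (fun x => u2 x * pd i psi x)).
  rewrite -integ_comb; try exact: integrable_mul.
  by congr (integ _ _); apply/funext => x; rewrite mulrDl !mulrA.
transitivity (- (a * integ Om (fun x => v1 x * psi x) +
              b * integ Om (fun x => v2 x * psi x))).
  rewrite h1// h2//; ring.
rewrite -integ_comb; try exact: integrable_mul.
by congr (- integ _ _); apply/funext => x; rewrite mulrDl !mulrA.
Qed.

Lemma weak_hess_comb (a b : R) u1 u2 g1 h1 g2 h2 :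
  weak_hess Om u1 g1 h1 -> weak_hess Om u2 g2 h2 ->
  weak_hess Om (fun x => a * u1 x + b * u2 x)
    (fun i x => a * g1 i x + b * g2 i x) (fun i x => a * h1 i x + b * h2 i x).
Proof.
move=> H1 H2 i; have [a1 b1] := H1 i; have [a2 b2] := H2 i.
by split; exact: weak_deriv_comb.
Qed.

Let sqr_normLp_ge0 p u : (0 <= normLp Om p u ^+ 2)%E.
Proof. by rewrite expe2 mule_ge0// Lnorm_ge0. Qed.

Lemma sqnormH_ge0 k u : (0 <= sqnormH Om k u)%E.
Proof.
elim: k u => [|k IH] u /=.
  by rewrite adde0; exact: sqr_normLp_ge0.
apply: adde_ge0; first exact: sqr_normLp_ge0.
apply: sume_ge0 => i _.
by apply/le_ereal_inf_tmp => _ [v _ <-].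
Qed.

Lemma inf_sqnormH_ge0 k i u :
  (0 <= ereal_inf [set sqnormH Om k v | v in weak_deriv Om i u])%E.
Proof. by apply/le_ereal_inf_tmp => _ [v _ <-]; exact: sqnormH_ge0. Qed.

(** An infimum below +oo is an infimum over a nonempty set, so finiteness of the
    Sobolev norm provides the weak derivatives. *)
Lemma sqnormH_lty k u : (sqnormH Om k.+1 u < +oo)%E ->
  (normLp Om 2%:E u < +oo)%E /\
  forall i, exists2 v, weak_deriv Om i u v & (sqnormH Om k v < +oo)%E.
Proof.
move=> /= h; split.
  have : (normLp Om 2%:E u ^+ 2 < +oo)%E.
    apply: le_lt_trans h; rewrite leeDl//; apply: sume_ge0 => i _.
    exact: inf_sqnormH_ge0.
  have : (0 <= normLp Om 2%:E u)%E by exact: Lnorm_ge0.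
  by case: (normLp _ _ _) => [r||]; rewrite ?ltry// expe2 mulyy.
move=> i.
have /ereal_inf_lt[_ [v uv <-] voo] :
    (ereal_inf [set sqnormH Om k v | v in weak_deriv Om i u] < +oo)%E.
  apply: le_lt_trans h; apply: (le_trans _ (leeDr _ (sqr_normLp_ge0 _ _))).
  rewrite (bigD1 i)//= leeDl//; apply: sume_ge0 => j _.
  exact: inf_sqnormH_ge0.
by exists v.
Qed.

Lemma inH2_hess u : inH Om 2 u -> L2 u /\ exists g h, weak_hess Om u g h.
Proof.
move=> [mu_ /sqnormH_lty[u2 du]]; split; first exact/inL2P.
have /choice[gh Hgh] i : exists p : (R * R -> R) * (R * R -> R),
    weak_deriv Om i u p.1 /\ weak_deriv Om i p.1 p.2.
  have [v uv /sqnormH_lty[_ /(_ i)[w vw _]]] := du i.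
  by exists (v, w).
by exists (fun i => (gh i).1), (fun i => (gh i).2).
Qed.

(** The Laplacian is chosen among the sums of pure second weak derivatives; the
    gradient that comes with the choice is needed to use the Neumann
    condition. *)
Lemma lap_hess u : (exists g h, weak_hess Om u g h) ->
  exists g h, weak_hess Om u g h /\ lap Om u = (fun x => \sum_(i < 2) h i x).
Proof.
move=> [g [h ugh]].
apply: (@xgetPex _ (cst 0) [set L | exists g h,
  weak_hess Om u g h /\ L = (fun x => \sum_(i < 2) h i x)]).
by exists (fun x => \sum_(i < 2) h i x), g, h.
Qed.

(** Together with sqnormH1_approx, this lets the extended-valued H^1 norm be
    replaced, up to an arbitrarily small error, by the norm computed from one
    explicit weak gradient. *)
Lemma sqnormH1_le u G : (forall i, weak_deriv Om i u (G i)) ->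
  (sqnormH Om 1 u <= (integ Om (fun x => u x ^+ 2) +
     \sum_(i < 2) integ Om (fun x => G i x ^+ 2))%:E)%E.
Proof.
move=> uG; rewrite EFinD -sumEFin /sqnormH; apply: leeD.
  by rewrite normL2_sqr//; have [/inL2P] := uG ord0.
apply: lee_sum => i _; apply: ereal_inf_lbound; exists (G i) => //.
by rewrite adde0 normL2_sqr//; have [_ /inL2P] := uG i.
Qed.

Lemma sqnormH1_approx u (c d : R) : L2 u -> 0 < d ->
  (sqnormH Om 1 u <= c%:E)%E ->
  exists2 G, (forall i, weak_deriv Om i u (G i)) &
    integ Om (fun x => u x ^+ 2) + \sum_(i < 2) integ Om (fun x => G i x ^+ 2)
      <= c + d.
Proof.
move=> u2 d0 uc.
pose I i := ereal_inf [set sqnormH Om 0 v | v in weak_deriv Om i u].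
have I0 i : (0 <= I i)%E by exact: inf_sqnormH_ge0.
have Ioo i : (I i < +oo)%E.
  have [_ /(_ i)[v uv voo]] := sqnormH_lty (le_lt_trans uc (ltry c)).
  by apply: le_lt_trans voo; apply: ereal_inf_lbound; exists v.
have Ifin i : I i \is a fin_num by rewrite ge0_fin_numE.
have /choice[G HG] i : exists v, weak_deriv Om i u v /\
    integ Om (fun x => v x ^+ 2) <= fine (I i) + d / 2.
  have [_ [v uv <-] vI] := lb_ereal_inf_adherent (divr_gt0 d0 (ltr0n _ 2)) (Ifin i).
  have v2 : L2 v by have [_ /inL2P] := uv.
  exists v; split => //; rewrite -lee_fin EFinD (fineK (Ifin i)) -(normL2_sqr v2).
  by move: vI; rewrite /= adde0 => /ltW.
exists G => [i|]; first by have [] := HG i.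
have : integ Om (fun x => u x ^+ 2) + \sum_(i < 2) fine (I i) <= c.
  rewrite -lee_fin EFinD -(normL2_sqr u2) -sumEFin.
  apply: le_trans uc; rewrite /sqnormH; apply: leeD => //.
  by apply: lee_sum => i _; rewrite (fineK (Ifin i)).
move=> uI; have Gd : \sum_(i < 2) integ Om (fun x => G i x ^+ 2) <=
    \sum_(i < 2) fine (I i) + d.
  apply: le_trans (ler_sum _ (fun i _ => (HG i).2)) _.
  by rewrite big_split/= sumr_const card_ord -[_ *+ 2]mulr_natr divfK// pnatr_eq0.
by apply: le_trans (lerD (lexx _) Gd) _; rewrite addrA lerD2r.
Qed.

(** The condition is stated for each of u1 and u0, but the scheme needs it for a
    weak Hessian (g, h) of their average that need not be the average of two
    given ones.  For any weak Hessian (g1, h1) of u1, the pair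
    (2 g - g1, 2 h - h1) is one of u0, and adding the two conditions leaves
    twice the desired identity. *)
Lemma neumann0_avg u1 u0 g h v k : neumann0 Om u1 -> neumann0 Om u0 ->
  weak_hess Om (fun x => (u1 x + u0 x) / 2) g h ->
  (forall i, weak_deriv Om i v (k i)) ->
  integ Om (fun x => (\sum_(i < 2) h i x) * v x + \sum_(i < 2) g i x * k i x) = 0.
Proof.
move=> [/inH2_hess[_ [g1 [h1 H1]]] N1] [_ N0] H vk.
have H0 := weak_hess_comb 2 (-1) H H1.
rewrite (_ : (fun x => 2 * _ + _) = u0) in H0; last by apply/funext => x; field.
have := N0 _ _ _ _ H0 vk; have := N1 _ _ _ _ H1 vk.
have Lv : L2 v by have [/inL2P] := vk ord0.
have Lk i : L2 (k i) by have [_ /inL2P] := vk i.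
have Lgh g' h' u' : weak_hess Om u' g' h' -> intble (fun x =>
    ((\sum_(i < 2) h' i x) * v x + \sum_(i < 2) g' i x * k i x)%:E).
  move=> H'.
  have Lg i : L2 (g' i) by have [[_ /inL2P]] := H' i.
  have Lh i : L2 (h' i) by have [_ [_ /inL2P]] := H' i.
  have := integrableD mOm
    (integrableD mOm (integrable_mul mOm (Lh ord0) Lv) (integrable_mul mOm (Lh ord_max) Lv))
    (integrableD mOm (integrable_mul mOm (Lg ord0) (Lk ord0)) (integrable_mul mOm (Lg ord_max) (Lk ord_max))).
  apply: eq_integrable => // x _; rewrite !big_ord_recr !big_ord0 /= !add0r.
  rewrite (_ : widen_ord _ _ = ord0); last exact/val_inj.
  by rewrite -!EFinD mulrDl.
move=> e1; set F := (X in integ Om X = 0).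
have -> : F = fun x => 2 * ((\sum_(i < 2) h i x) * v x + \sum_(i < 2) g i x * k i x) +
    (-1) * ((\sum_(i < 2) h1 i x) * v x + \sum_(i < 2) g1 i x * k i x).
  by apply/funext => x; rewrite /F !big_ord_recr !big_ord0 /=; ring.
rewrite integ_comb; [|exact: Lgh H|exact: Lgh H1].
by rewrite e1; lra.
Qed.

End WeakDerivatives.

Section AeIn.
Context {R : realType} (Om : set (R * R)).
Implicit Types P Q : R * R -> Prop.

Lemma ae_in_impl P Q : (forall x, Om x -> P x -> Q x) -> ae_in Om P -> ae_in Om Q.
Proof.
move=> PQ; apply: (@filterS _ (almost_everywhere (@leb2 R))) => x Px Ox.
by apply: PQ => //; exact: Px.
Qed.

Lemma ae_in_and P Q : ae_in Om P -> ae_in Om Q -> ae_in Om (fun x => P x /\ Q x).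
Proof.
apply: (@filterS2 _ (almost_everywhere (@leb2 R))) => x Px Qx Ox.
by split; [exact: Px | exact: Qx].
Qed.

End AeIn.

(** * Bounds on the exact solution at every time *)

Section AeBound.
Context d {T : measurableType d} {R : realType}.
Variable mu : {measure set T -> \bar R}.

Lemma ae_bound_normr_Rintegral (D : set T) (f : T -> R) (M : R) :
  measurable D -> (mu D < +oo)%E -> measurable_fun D f ->
  {ae mu, forall x, D x -> `|f x| <= M} ->
  `|\int[mu]_(x in D) f x| <= M * fine (mu D).
Proof.
move=> mD muD mf fM.
have If : mu.-integrable D (EFin \o f).
  exact/integrable_sqint/(ae_bounded_sqint mD muD mf fM).
apply: le_trans (le_normr_Rintegral mD If) _.
rewrite -(Rintegral_cst mu mD); apply: ae_le_Rintegral => //.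
  exact: integrable_norm.
exact/integrable_sqint/sqint_cst.
Qed.

End AeBound.

Section ExactSolution.
Context {R : realType} (Om : set (R * R)) (T : R).
Hypothesis Om_open : open Om.
Hypothesis Om_bounded : bounded_set Om.
Hypothesis T_gt0 : 0 < T.

Local Notation L2 := (sqint (@leb2 R) (Om : set (mR2 R))).

Let mOm : measurable (Om : set (mR2 R)).
Proof. exact: open_measurable_plane. Qed.

Lemma measurable_time_slice (f : R -> R * R -> R) (t : R) :
  measurable_fun (`[0, T] `*` Om : set (mR R * mR2 R))
    ((fun z => f z.1 z.2) : mR R * mR2 R -> mR R) ->
  0 <= t <= T -> measurable_fun (Om : set (mR2 R)) (f t : mR2 R -> mR R).
Proof.
move=> mf t0T _ Y mY.
have mA : measurable (`[0, T] `*` Om : set (mR R * mR2 R)).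
  by apply: measurableX => //; exact: measurable_itv.
have := measurable_xsection t (mf mA Y mY); congr (measurable _).
apply/seteqP; split => x; rewrite /xsection /= inE /= in_itv/= t0T.
  by move=> [[_]].
by move=> [].
Qed.

Lemma measurable_space_slice (f : R -> R * R -> R) (x : R * R) :
  measurable_fun (`[0, T] `*` Om : set (mR R * mR2 R))
    ((fun z => f z.1 z.2) : mR R * mR2 R -> mR R) ->
  Om x -> measurable_fun (`[0, T]%classic : set (mR R)) ((fun t => f t x) : mR R -> mR R).
Proof.
move=> mf Ox _ Y mY.
have mA : measurable (`[0, T] `*` Om : set (mR R * mR2 R)).
  by apply: measurableX => //; exact: measurable_itv.
have := measurable_ysection x (mf mA Y mY); congr (measurable _).
apply/seteqP; split => t; rewrite /ysection /= inE /=.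
  by move=> [[]].
by move=> [].
Qed.

Lemma normLoo_ae u (M : R) : (normLp Om +oo%E u <= M%:E)%E ->
  ae_in Om (fun x => `|u x| <= M).
Proof.
rewrite /normLp unlock; case: ifPn => [mu0 /ess_supP|].
  apply: filterS => x /= + Ox; rewrite patchE mem_set//.
rewrite -leNgt => muT _.
have /= muT0 : (@leb2 R) setT = 0%E by apply/eqP; rewrite eq_le muT measure_ge0.
by exists setT; split.
Qed.

(** The regularity hypothesis bounds the time derivative for almost every t and
    then almost every x; integrating in time at fixed x needs the quantifiers
    in the other order. *)
Lemma phit_ae_bounded (phit : R -> R * R -> R) :
  inLpX Om T +oo (normLp Om +oo) phit ->
  exists2 M : R, 0 <= M & ae_in Om (fun x =>
    {ae @leb R, forall t : mR R, 0 <= t <= T -> `|phit t x| <= M}).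
Proof.
move=> [mphit /Lnormy_ae_bounded[M M0 aeM]]; exists M => //.
have mA : measurable (`[0, T] `*` Om : set (mR R * mR2 R)).
  by apply: measurableX => //; exact: measurable_itv.
pose E : set (mR R * mR2 R) := (`[0, T] `*` Om) `&`
  (fun z => phit z.1 z.2) @^-1` (~` `[- M, M]%classic).
have mE : measurable E.
  by apply: mphit => //; apply: measurableC; exact: measurable_itv.
have := @ae_section_swap _ _ _ _ _ (@lebesgue_measure R) (@plane_measure R) E mE.
have H1 : {ae @leb R, forall t, {ae @leb2 R, forall x, ~ E (t, x)}}.
  apply: filterS aeM => t.
  have [t0T|t0T _] := boolP (t \in `[0, T]%classic); last first.
    apply: filterS (filterT : {ae @leb2 R, forall x, True}) => x _ [[/= tin _] _].
    by rewrite notin_setE in t0T.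
  rewrite patchE t0T gee0_abs; last exact: Lnorm_ge0.
  move=> /normLoo_ae phitM; change {ae @leb2 R, forall x, ~ E (t, x)}.
  refine (@filterS _ (almost_everywhere (@leb2 R)) _ _ _ _ phitM) => x xM [[/= _ Ox] /=].
  by rewrite in_itv/= -ler_norml; apply; exact: xM.
move=> /(_ H1); apply: filterS => x xE Ox.
apply: filterS xE => t tE /= t0T; have [//|Mx] := leP `|phit t x| M; case: tE.
split; first by split; rewrite //= in_itv.
by rewrite /= in_itv/= -ler_norml leNgt Mx.
Qed.

Variables phi phit : R -> R * R -> R.
Hypothesis phi_time_deriv : time_deriv Om T phi phit.
Hypothesis phit_Loo : inLpX Om T +oo (normLp Om +oo) phit.

Lemma exact_lipschitz_in_time : exists2 M : R, 0 <= M &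
  forall s t, 0 <= s -> s <= t -> t <= T ->
    ae_in Om (fun x => `|phi t x - phi s x| <= M * (t - s)).
Proof.
have [M M0 aeM] := phit_ae_bounded phit_Loo; exists M => // s t s0 st tT.
apply: ae_in_impl (ae_in_and aeM (phi_time_deriv s0 st tT)) => x Ox [xM ->].
have mst : measurable (`[s, t]%classic : set (mR R)) by exact: measurable_itv.
have lst : (@leb R `[s, t]%classic = (t - s)%:E)%E.
  rewrite [LHS]lebesgue_measure_itv/= lte_fin; have [//|ts] := ltP s t.
  by rewrite (@le_anti _ _ s t) ?st// subrr.
have -> : M * (t - s) = M * fine (@leb R `[s, t]%classic) by rewrite lst.
have sub : `[s, t]%classic `<=` `[0, T]%classic.
  move=> r; rewrite /= !in_itv/= => /andP[sr rt].
  by rewrite (le_trans s0 sr) (le_trans rt tT).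
apply: ae_bound_normr_Rintegral => //.
- by rewrite lst ltry.
- apply: (measurable_funS _ sub); first exact: measurable_itv.
  by apply: measurable_space_slice => //; have [] := phit_Loo.
- apply: filterS xM => r rM /sub; rewrite /= in_itv/=; exact: rM.
Qed.

Hypothesis Om_sobolev : sobolev_inequalities Om.

(** From the bound of the L^oo norm by the norms of H^1 and H^2, both finite
    since the first weak derivatives of a function of H^2 are in L^2. *)
Lemma inH2_ae_bounded u : inH Om 2 u ->
  exists2 B : R, 0 <= B & ae_in Om (fun x => `|u x| <= B).
Proof.
move=> H2; have [C [_ /(_ _ H2) S]] := Om_sobolev.
have H2oo : (sqnormH Om 2 u < +oo)%E by have [] := H2.
have H1oo : (sqnormH Om 1 u < +oo)%E.
  have [_ [g [h ugh]]] := inH2_hess Om_open H2.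
  apply: le_lt_trans (ltry _).
  by apply: (sqnormH1_le Om_open (G := g)) => i; have [] := ugh i.
have nfin k : (sqnormH Om k u < +oo)%E -> normH Om k u \is a fin_num.
  by move=> koo; rewrite ge0_fin_numE ?poweR_ge0// poweR_lty.
have uoo : (normLp Om +oo%E u < +oo)%E.
  have : (normLp Om +oo%E u ^+ 2 < +oo)%E.
    apply: le_lt_trans S _; rewrite ltey_eq.
    by apply/orP; left; rewrite !fin_numM ?nfin.
  have : (0 <= normLp Om +oo%E u)%E by exact: Lnorm_ge0.
  by case: (normLp _ _ _) => [r||]; rewrite ?ltry// expe2 mulyy.
have [B B0 uB] := Lnormy_ae_bounded uoo; exists B => //.
refine (@filterS _ (almost_everywhere (@leb2 R)) _ _ _ _ uB) => x /= + Ox.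
by rewrite patchE mem_set.
Qed.

(** Boundedness at the single time T propagates to all times by the Lipschitz
    bound. *)
Lemma exact_ae_bounded : inH Om 2 (phi T) ->
  exists2 B : R, 0 <= B & forall t, 0 <= t <= T -> ae_in Om (fun x => `|phi t x| <= B).
Proof.
move=> /inH2_ae_bounded[B B0 phiT]; have [M M0 lip] := exact_lipschitz_in_time.
exists (B + M * T); first by rewrite addr_ge0// mulr_ge0// ltW.
move=> t /andP[t0 tT].
apply: ae_in_impl (ae_in_and phiT (lip t T t0 tT (lexx _))) => x _ [h2].
rewrite distrC => h1.
have := ler_distD (phi T x) (phi t x) 0; rewrite !subr0 => h3.
have : M * (T - t) <= M * T by rewrite ler_wpM2l// gerBl.
by lra.
Qed.

End ExactSolution.

(** * The energy identity for the errors *)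

Section EnergyStep.

Lemma young (R : realFieldType) (x y e : R) : 0 < e ->
  x * y <= x ^+ 2 / (2 * e) + e * y ^+ 2 / 2.
Proof.
move=> e0.
have -> : x ^+ 2 / (2 * e) + e * y ^+ 2 / 2 = x * y + (x - e * y) ^+ 2 / (2 * e).
  by field; rewrite gt_eqF.
by rewrite lerDl divr_ge0 ?sqr_ge0// mulr_ge0// ltW.
Qed.

(** The variables are the values at one point: a, b, am are the phi-errors at
    the levels n, n+1, n-1; p, r and z0, z1 the q- and zeta-errors at n, n+1;
    L is the difference of the Laplacians, gU the numerical gbar, dg the
    difference of the two gbar, qV the averaged exact q, dV the increment of
    the exact phi.  Multiplying the first equation by b - a and the second by
    r + p, the products with gU cancel; the term (b - a)^2 / tau left over
    absorbs every product with the increment b - a.  The weight tau / (4 T) of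
    the remaining Young inequality makes the implicit terms small for every
    tau <= T. *)
Lemma pointwise_energy (R : realFieldType)
    (gam1 gam2 s tau T Q M Lg a b am p r z0 z1 L dg gU qV dV R1 R2 : R) :
  0 < tau -> 0 < T ->
  `|qV| <= Q -> `|dV| <= M * tau ->
  `|dg| <= Lg * (3 / 2 * `|a| + 1 / 2 * `|am|) ->
  (b - a) / tau - gam1 * L + 2 * gam2 * ((b + a) / 2)
    + 2 * (qV * dg + (r + p) / 2 * gU) + s * ((z1 + z0) / 2) = R1 ->
  r - p - gU * (b - a) - dg * dV = R2 ->
  - gam1 * (L * (b - a)) + gam2 * (b ^+ 2 - a ^+ 2) + (r ^+ 2 - p ^+ 2)
    + s * ((z1 + z0) / 2) * (b - a) <=
  tau * R1 ^+ 2
    + tau * ((2 * Q ^+ 2 + 4 * T * M ^+ 2) * (9 / 2 * Lg ^+ 2))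
        * (a ^+ 2 + am ^+ 2)
    + tau / (4 * T) * (p ^+ 2 + r ^+ 2) + 4 * T / tau * R2 ^+ 2.
Proof.
move=> tau0 T0 qVQ dVM dgL e1 e2.
have tauN0 : tau != 0 by rewrite gt_eqF.
have TN0 : T != 0 by rewrite gt_eqF.
have sqle (x B : R) : `|x| <= B -> x ^+ 2 <= B ^+ 2.
  by move=> xB; rewrite -[x ^+ 2]real_normK ?num_real// lerXn2r ?nnegrE// (le_trans _ xB).
have qV2 := sqle _ _ qVQ; have dV2 := sqle _ _ dVM; have dg2 := sqle _ _ dgL.
(* The cancellation of the products with gU happens in this identity. *)
have -> : - gam1 * (L * (b - a)) + gam2 * (b ^+ 2 - a ^+ 2) + (r ^+ 2 - p ^+ 2)
    + s * ((z1 + z0) / 2) * (b - a) =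
  (b - a) * R1 + (b - a) * (- 2 * (qV * dg)) - (b - a) ^+ 2 / tau
    + (dg * dV + R2) * (p + r).
  by rewrite -e1 -e2; field.
have y1 := young (b - a) R1 tau0.
have y2 := young (b - a) (- 2 * (qV * dg)) tau0.
have e0 : 0 < tau / (4 * T) by rewrite divr_gt0// mulr_gt0.
have y3 := young (dg * dV + R2) (p + r) e0.
have {}y3 : (dg * dV + R2) * (p + r) <=
    2 * T / tau * (dg * dV + R2) ^+ 2 + tau / (4 * T) * ((p + r) ^+ 2 / 2).
  apply: le_trans y3 _; rewrite le_eqVlt; apply/orP; left; apply/eqP; by field; rewrite ?tauN0 ?TN0.
have c0 : 0 <= 2 * T / tau by rewrite divr_ge0 ?mulr_ge0 ?ltW.
have F2 : (dg * dV + R2) ^+ 2 <= 2 * (dg ^+ 2 * (M * tau) ^+ 2) + 2 * R2 ^+ 2.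
  have := ler_wpM2l (sqr_ge0 dg) dV2; have := sqr_ge0 (dg * dV - R2).
  rewrite -exprMn => h1 h2; lra.
have {}F2 := ler_wpM2l c0 F2.
have pr : (p + r) ^+ 2 / 2 <= p ^+ 2 + r ^+ 2.
  have := sqr_ge0 (p - r); lra.
have {}pr := ler_wpM2l (ltW e0) pr.
have q2 : (qV * dg) ^+ 2 <= Q ^+ 2 * dg ^+ 2.
  by rewrite exprMn ler_wpM2r ?sqr_ge0.
have {}q2 := ler_wpM2l (ltW tau0) q2.
have dg3 : dg ^+ 2 <= 9 / 2 * Lg ^+ 2 * (a ^+ 2 + am ^+ 2).
  apply: le_trans dg2 _; rewrite exprMn.
  have -> : 9 / 2 * Lg ^+ 2 * (a ^+ 2 + am ^+ 2) =
    Lg ^+ 2 * (9 / 2 * (a ^+ 2 + am ^+ 2)) by ring.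
  rewrite ler_wpM2l ?sqr_ge0//.
  rewrite -(real_normK (num_real a)) -(real_normK (num_real am)).
  have := sqr_ge0 (3 / 2 * `|a| - 1 / 2 * `|am|); have := sqr_ge0 `|am|; lra.
have k0 : 0 <= tau * (2 * Q ^+ 2 + 4 * T * M ^+ 2).
  by rewrite mulr_ge0 ?(ltW tau0)// addr_ge0// mulr_ge0 ?sqr_ge0// mulr_ge0// ltW.
have {}dg3 := ler_wpM2l k0 dg3.
have E1 : 2 * T / tau * (2 * (dg ^+ 2 * (M * tau) ^+ 2) + 2 * R2 ^+ 2) =
  tau * (4 * T * M ^+ 2) * dg ^+ 2 + 4 * T / tau * R2 ^+ 2 by field.
have E2 : (b - a) ^+ 2 / (2 * tau) = (b - a) ^+ 2 / tau / 2 by field.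
have R10 := mulr_ge0 (ltW tau0) (sqr_ge0 R1).
rewrite E1 in F2; rewrite E2 in y1 y2.
have E3 : tau * (- 2 * (qV * dg)) ^+ 2 / 2 = 2 * (tau * (qV * dg) ^+ 2) by field.
rewrite E3 in y2.
have E5 : tau * ((2 * Q ^+ 2 + 4 * T * M ^+ 2) * (9 / 2 * Lg ^+ 2)) * (a ^+ 2 + am ^+ 2) =
  tau * (2 * Q ^+ 2 + 4 * T * M ^+ 2) * (9 / 2 * Lg ^+ 2 * (a ^+ 2 + am ^+ 2)) by ring.
rewrite E5; lra.
Qed.

End EnergyStep.

Section IntegratedEnergy.
Context {R : realType} (Om : set (R * R)).
Hypothesis Om_open : open Om.
Hypothesis Om_bounded : bounded_set Om.
Implicit Types (u v : R * R -> R) (i : 'I_2).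

Local Notation L2 := (sqint (@leb2 R) (Om : set (mR2 R))).
Local Notation intble := ((@leb2 R).-integrable (Om : set (mR2 R))).

Local Notation I2 u := (integ Om (fun x => u x ^+ 2)).

Let mOm : measurable (Om : set (mR2 R)).
Proof. exact: open_measurable_plane. Qed.

Let muOm : (@leb2 R Om < +oo)%E.
Proof. exact: bounded_finite_measure_plane. Qed.

Let intD (f g : R * R -> R) : intble (EFin \o f) -> intble (EFin \o g) ->
  intble (EFin \o (fun x => f x + g x)).
Proof. by move=> If Ig; have := integrableD mOm If Ig; apply: eq_integrable. Qed.

Let intZ (c : R) (f : R * R -> R) : intble (EFin \o f) ->
  intble (EFin \o (fun x => c * f x)).
Proof. by move=> If; have := integrableZl mOm c If; apply: eq_integrable. Qed.

Let integD (f g : R * R -> R) : intble (EFin \o f) -> intble (EFin \o g) ->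
  integ Om (fun x => f x + g x) = integ Om f + integ Om g.
Proof. by move=> If Ig; rewrite /integ RintegralD. Qed.

Let integZ (c : R) (f : R * R -> R) : intble (EFin \o f) ->
  integ Om (fun x => c * f x) = c * integ Om f.
Proof. by move=> If; rewrite /integ RintegralZl. Qed.

Let integB (f g : R * R -> R) : intble (EFin \o f) -> intble (EFin \o g) ->
  integ Om (fun x => f x - g x) = integ Om f - integ Om g.
Proof. by move=> If Ig; rewrite /integ RintegralB. Qed.

Lemma integrated_energy (c1 c2 c3 k1 k2 k3 k4 : R) (a b am p r L R1 R2 : R * R -> R) :
  L2 a -> L2 b -> L2 am -> L2 p -> L2 r -> L2 L -> L2 R1 -> L2 R2 ->
  ae_in Om (fun x =>
    c1 * (L x * (b x - a x)) + c2 * (b x ^+ 2 - a x ^+ 2)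
      + (r x ^+ 2 - p x ^+ 2) + c3 * (b x - a x) <=
    k1 * R1 x ^+ 2 + k2 * (a x ^+ 2 + am x ^+ 2)
      + k3 * (p x ^+ 2 + r x ^+ 2) + k4 * R2 x ^+ 2) ->
  c1 * integ Om (fun x => L x * (b x - a x)) + c2 * (I2 b - I2 a)
    + (I2 r - I2 p) + c3 * integ Om (fun x => b x - a x) <=
  k1 * I2 R1 + k2 * (I2 a + I2 am) + k3 * (I2 p + I2 r) + k4 * I2 R2.
Proof.
move=> La Lb Lam Lp Lr LL LR1 LR2 ineq.
have sq u : L2 u -> intble (EFin \o (fun x => u x ^+ 2)) by case.
have intB u v : intble (EFin \o u) -> intble (EFin \o v) ->
    intble (EFin \o (fun x => u x - v x)).
  move=> Iu Iv; have := intD Iu (intZ (-1) Iv).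
  by apply: eq_integrable => // x _ /=; rewrite mulN1r.
have Iba : intble (EFin \o (fun x => b x - a x)).
  exact/(integrable_sqint mOm muOm)/sqintB.
have ILba : intble (EFin \o (fun x => L x * (b x - a x))).
  by apply: integrable_mul => //; exact: sqintB.
have J1 := intZ c1 ILba.
have J2 := intZ c2 (intB _ _ (sq _ Lb) (sq _ La)).
have J3 := intB _ _ (sq _ Lr) (sq _ Lp).
have J4 := intZ c3 Iba.
have J12 := intD J1 J2; have J123 := intD J12 J3.
have K1 := intZ k1 (sq _ LR1).
have K2 := intZ k2 (intD (sq _ La) (sq _ Lam)).
have K3 := intZ k3 (intD (sq _ Lp) (sq _ Lr)).
have K4 := intZ k4 (sq _ LR2).
have K12 := intD K1 K2; have K123 := intD K12 K3.
have := ae_le_Rintegral mOm (intD J123 J4) (intD K123 K4) ineq.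
rewrite -!/(integ Om _) (integD J123 J4) (integD J12 J3) (integD J1 J2).
rewrite (integZ c1 ILba) (integZ c2 (intB _ _ (sq _ Lb) (sq _ La))) (integZ c3 Iba).
rewrite (integB (sq _ Lb) (sq _ La)) (integB (sq _ Lr) (sq _ Lp)).
rewrite (integD K123 K4) (integD K12 K3) (integD K1 K2).
rewrite (integZ k1 (sq _ LR1)) (integZ k2 (intD (sq _ La) (sq _ Lam))).
rewrite (integZ k3 (intD (sq _ Lp) (sq _ Lr))) (integZ k4 (sq _ LR2)).
rewrite (integD (sq _ La) (sq _ Lam)) (integD (sq _ Lp) (sq _ Lr)) => h.
exact: h.
Qed.

(** Testing an average with an increment gives half the increment of the
    squares. *)
Lemma sqnorm_polarization (G0 G1 g k : R * R -> R) : L2 G0 -> L2 G1 ->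
  (forall x, g x = (G1 x + G0 x) / 2) -> (forall x, k x = G1 x - G0 x) ->
  intble (EFin \o (fun x => g x * k x)) /\
  integ Om (fun x => g x * k x) =
    (integ Om (fun x => G1 x ^+ 2) - integ Om (fun x => G0 x ^+ 2)) / 2.
Proof.
move=> [_ L0] [_ L1] gE kE.
have I := intD (intZ (1 / 2) L1) (intZ (- 1 / 2) L0).
have E : (fun x => g x * k x) =
    (fun x => 1 / 2 * G1 x ^+ 2 + - 1 / 2 * G0 x ^+ 2).
  by apply/funext => x; rewrite gE kE; field.
rewrite E; split => //.
rewrite (integD (intZ (1 / 2) L1) (intZ (- 1 / 2) L0)) (integZ _ L1) (integZ _ L0).
by field.
Qed.

End IntegratedEnergy.

(** * The discrete Gronwall argument *)

Section DiscreteGronwall.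

Definition error_energy (R : realFieldType) (gam1 gam2 D A P z : R) : R :=
  gam1 / 2 * D + gam2 * A + P + z ^+ 2 / 2.

(** The integrated inequality in terms of the energies.  The letters D, A, P
    stand for the squared norms of grad e_phi, e_phi, e_q, with index 1 at the
    new level, 0 at the current one and m at the previous one; J is the
    integral of the Laplacian against the increment, S that of the increment,
    r1, r2 are squared truncation norms.  The scalar equation for z turns the
    nonlocal term s S (z1 + z0) / 2 into the increment of z^2 / 2. *)
Lemma energy_balance (R : realFieldType)
    (gam1 gam2 s tau T KK K K3 D1 D0 A1 A0 Am P1 P0 z1 z0 J S r1 r2 R3 : R) :
  0 < gam1 -> 0 < gam2 -> 0 < tau -> 0 < T ->
  0 <= D1 -> 0 <= D0 -> 0 <= A1 -> 0 <= A0 ->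
  J = - (D1 - D0) / 2 -> z1 - z0 - s * S = R3 ->
  r1 <= (K * tau ^+ 2) ^+ 2 -> r2 <= (tau * (K * tau ^+ 2)) ^+ 2 ->
  R3 ^+ 2 <= K3 * tau ^+ 6 ->
  - gam1 * J + gam2 * (A1 - A0) + (P1 - P0) + s * ((z1 + z0) / 2) * S <=
    tau * r1 + tau * KK * (A0 + Am) + tau / (4 * T) * (P0 + P1)
      + 4 * T / tau * r2 ->
  error_energy gam1 gam2 D1 A1 P1 z1 - error_energy gam1 gam2 D0 A0 P0 z0 <=
    tau / (4 * T) * (error_energy gam1 gam2 D1 A1 P1 z1
                     + error_energy gam1 gam2 D0 A0 P0 z0)
    + tau * (KK / gam2) * (gam2 * A0 + gam2 * Am)
    + (K ^+ 2 + 4 * T * K ^+ 2 + T * K3) * tau ^+ 5.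
Proof.
move=> g1 g2 tau0 T0 D10 D00 A10 A00 -> hz hr1 hr2 hR3 main.
have tauN0 : tau != 0 by rewrite gt_eqF.
have TN0 : T != 0 by rewrite gt_eqF.
have g2N0 : gam2 != 0 by rewrite gt_eqF.
have e0 : 0 < tau / (2 * T) by rewrite divr_gt0// mulr_gt0.
have zR := young R3 ((z1 + z0) / 2) e0.
have zavg : s * ((z1 + z0) / 2) * S = (z1 ^+ 2 - z0 ^+ 2) / 2 - R3 * ((z1 + z0) / 2).
  by rewrite -hz; field.
rewrite zavg in main.
have {}zR : R3 * ((z1 + z0) / 2) <= T / tau * R3 ^+ 2 + tau / (8 * T) * (z1 ^+ 2 + z0 ^+ 2).
  apply: le_trans zR _; apply: lerD.
    by rewrite le_eqVlt; apply/orP; left; apply/eqP; field; rewrite ?tauN0 ?TN0.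
  have -> : tau / (2 * T) * ((z1 + z0) / 2) ^+ 2 / 2 =
    tau / (8 * T) * ((z1 + z0) ^+ 2 / 2) by field.
  rewrite ler_wpM2l//; first by rewrite divr_ge0 ?mulr_ge0 ?ltW.
  by have := sqr_ge0 (z1 - z0); lra.
have h1 := ler_wpM2l (ltW tau0) hr1.
have c2 : 0 <= 4 * T / tau by rewrite divr_ge0 ?mulr_ge0 ?ltW.
have h2 := ler_wpM2l c2 hr2.
have c3 : 0 <= T / tau by rewrite divr_ge0 ?ltW.
have h3 := ler_wpM2l c3 hR3.
have k1 : tau * (K * tau ^+ 2) ^+ 2 = K ^+ 2 * tau ^+ 5 by ring.
have k2 : 4 * T / tau * (tau * (K * tau ^+ 2)) ^+ 2 = 4 * T * K ^+ 2 * tau ^+ 5 by field.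
have k3 : T / tau * (K3 * tau ^+ 6) = T * K3 * tau ^+ 5 by field.
rewrite k1 in h1; rewrite k2 in h2; rewrite k3 in h3.
have pos : 0 <= tau / (4 * T) * (gam1 / 2 * (D1 + D0) + gam2 * (A1 + A0)).
  apply: mulr_ge0; first by rewrite divr_ge0 ?mulr_ge0 ?ltW.
  apply: addr_ge0; apply: mulr_ge0; rewrite ?addr_ge0//; last exact: ltW.
  by rewrite divr_ge0// ltW.
have E1 : tau * (KK / gam2) * (gam2 * A0 + gam2 * Am) = tau * KK * (A0 + Am) by field.
have E2 : tau / (4 * T) * (error_energy gam1 gam2 D1 A1 P1 z1
    + error_energy gam1 gam2 D0 A0 P0 z0) =
  tau / (4 * T) * (gam1 / 2 * (D1 + D0) + gam2 * (A1 + A0))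
  + tau / (4 * T) * (P0 + P1) + tau / (8 * T) * (z1 ^+ 2 + z0 ^+ 2).
  by rewrite /error_energy; field.
rewrite E1 E2 /error_energy; lra.
Qed.

(** The energy E1 occurs on both sides, with a weight tau / (4 T) <= 1/4 on the
    right; dividing by 1 - tau / (4 T) costs only a factor 1 + O(tau). *)
Lemma implicit_step_growth (R : realFieldType) (T tau kappa rho m E0 E1 A B : R) :
  0 < T -> 0 < tau -> tau <= T -> 0 <= kappa -> 0 <= rho -> 0 <= m ->
  E0 <= m -> A <= m -> B <= m ->
  E1 - E0 <= tau / (4 * T) * (E1 + E0) + tau * kappa * (A + B) + rho ->
  E1 <= (1 + (1 / T + 4 * kappa) * tau) * m + 2 * rho.
Proof.
move=> T0 tau0 tauT kap0 rho0 m0 E0m Am Bm main.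
pose x := tau / (4 * T).
have x0 : 0 <= x by rewrite divr_ge0 ?mulr_ge0 ?ltW.
have x4 : 4 * x <= 1 by rewrite /x invfM mulrCA (mulrA 4) divff// mul1r ler_pdivrMr ?mul1r.
have -> : (1 / T + 4 * kappa) * tau = 4 * x + 4 * (tau * kappa).
  by rewrite /x; field; rewrite gt_eqF.
rewrite -/x in main; have y0 : 0 <= tau * kappa by rewrite mulr_ge0// ltW.
move: x (tau * kappa) x0 x4 y0 main => {tau tau0 tauT kap0 kappa T T0} x y x0 x4 y0 main.
have xm : 0 <= x * m by exact: mulr_ge0.
have ym : 0 <= y * m by exact: mulr_ge0.
have h1 : x * E0 <= x * m by exact: ler_wpM2l.
have h2 : y * (A + B) <= y * (2 * m) by rewrite ler_wpM2l//; lra.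
have h3 : (1 - x) * E1 <= (1 + x + 2 * y) * m + rho by lra.
have h4 : 4 * x * (x * m) <= 1 * (x * m) by rewrite ler_wpM2r.
have h5 : 4 * x * (y * m) <= 1 * (y * m) by rewrite ler_wpM2r.
have h6 : 4 * x * rho <= 1 * rho by rewrite ler_wpM2r.
have : (1 - x) * E1 <= (1 - x) * ((1 + (4 * x + 4 * y)) * m + 2 * rho) by lra.
by rewrite ler_pM2l//; lra.
Qed.

(** There are N = T / tau steps, so the local defects of order tau^5 add up to
    order tau^4. *)
Lemma gronwall_bound (R : realType) (c T A rho tau : R) (n N : nat) :
  0 <= c -> 0 <= A -> 0 <= rho -> 0 <= tau -> (n <= N)%N -> N%:R * tau = T ->
  (1 + c * tau) ^+ n * (A * tau ^+ 4 + n%:R * (rho * tau ^+ 5)) <=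
    expR (c * T) * (A + rho * T) * tau ^+ 4.
Proof.
move=> c0 A0 rho0 tau0 nN NT.
have t4 : 0 <= tau ^+ 4 by exact: exprn_ge0.
have nT : n%:R * tau <= T by rewrite -NT ler_wpM2r// ler_nat.
have nT0 : 0 <= n%:R * tau by exact: mulr_ge0.
have -> : A * tau ^+ 4 + n%:R * (rho * tau ^+ 5) =
  (A + rho * (n%:R * tau)) * tau ^+ 4 by ring.
rewrite mulrA ler_wpM2r// ler_pM//.
- by rewrite exprn_ge0// addr_ge0// mulr_ge0.
- by rewrite addr_ge0// mulr_ge0.
- apply: (@le_trans _ _ (expR (c * tau) ^+ n)).
    by rewrite lerXn2r ?nnegrE ?expR_ge0 ?expR_ge1Dx// addr_ge0// mulr_ge0.
  by rewrite -expRM_natl ler_expR mulrCA ler_wpM2l.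
- by rewrite lerD2l ler_wpM2l.
Qed.

End DiscreteGronwall.

(** * The Laplacian tested with the increment of the error *)

Section NeumannEnergy.
Context {R : realType} (Om : set (R * R)).
Hypothesis Om_open : open Om.
Hypothesis Om_bounded : bounded_set Om.
Implicit Types (u w : R * R -> R) (i : 'I_2).

Local Notation L2 := (sqint (@leb2 R) (Om : set (mR2 R))).
Local Notation intble := ((@leb2 R).-integrable (Om : set (mR2 R))).

Let mOm : measurable (Om : set (mR2 R)).
Proof. exact: open_measurable_plane. Qed.

Lemma avg_weak_hess u1 u0 : inH Om 2 u1 -> inH Om 2 u0 ->
  exists g h, weak_hess Om (fun x => (u1 x + u0 x) / 2) g h /\
    lap Om (fun x => (u1 x + u0 x) / 2) = (fun x => \sum_(i < 2) h i x).
Proof.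
move=> /(inH2_hess Om_open)[_ [g1 [h1 H1]]] /(inH2_hess Om_open)[_ [g0 [h0 H0]]].
apply: lap_hess.
have := weak_hess_comb Om_open Om_bounded (1 / 2) (1 / 2) H1 H0.
rewrite (_ : (fun x => 1 / 2 * _ + _) = (fun x => (u1 x + u0 x) / 2)).
  by move=> H; do 2 eexists; exact: H.
by apply/funext => x; field.
Qed.

Lemma lap_avg_sqint u1 u0 : inH Om 2 u1 -> inH Om 2 u0 ->
  L2 (lap Om (fun x => (u1 x + u0 x) / 2)).
Proof.
move=> H1 H0; have [g [h [H ->]]] := avg_weak_hess H1 H0.
have Lh i : L2 (h i) by have [_ [_ /(inL2P Om_open)]] := H i.
have := sqintD mOm (Lh ord0) (Lh ord_max).
congr sqint; apply/funext => x; rewrite !big_ord_recr big_ord0 /= add0r.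
by congr (h _ x + _); exact/val_inj.
Qed.

(** Given a weak gradient G0 of the error u0 - w0, the gradient G1 of u1 - w1 is
    chosen so that (G1 + G0) / 2 is exactly the difference of the gradients
    that come with the Laplacians of the two averages.  With this choice the
    Neumann conditions give the identity without comparing different weak
    gradients of the same function. *)
Lemma neumann_laplacian_energy u1 u0 w1 w0 (G0 : 'I_2 -> R * R -> R) :
  neumann0 Om u1 -> neumann0 Om u0 -> neumann0 Om w1 -> neumann0 Om w0 ->
  (forall i, weak_deriv Om i (fun x => u0 x - w0 x) (G0 i)) ->
  exists G1 : 'I_2 -> R * R -> R,
    (forall i, weak_deriv Om i (fun x => u1 x - w1 x) (G1 i)) /\
    integ Om (fun x =>
      (lap Om (fun y => (u1 y + u0 y) / 2) x - lap Om (fun y => (w1 y + w0 y) / 2) x)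
      * ((u1 x - w1 x) - (u0 x - w0 x))) =
    - (\sum_(i < 2) integ Om (fun x => G1 i x ^+ 2)
       - \sum_(i < 2) integ Om (fun x => G0 i x ^+ 2)) / 2.
Proof.
move=> Nu1 Nu0 Nw1 Nw0 H0.
have Lu := lap_avg_sqint Nu1.1 Nu0.1; have Lw := lap_avg_sqint Nw1.1 Nw0.1.
have [gu [hu [Hu lapu]]] := avg_weak_hess Nu1.1 Nu0.1.
have [gw [hw [Hw lapw]]] := avg_weak_hess Nw1.1 Nw0.1.
pose G1 i x := 2 * (gu i x - gw i x) - G0 i x.
have HG1 i : weak_deriv Om i (fun x => u1 x - w1 x) (G1 i).
  have := weak_deriv_comb Om_open Om_bounded 2 (-1)
    (weak_deriv_comb Om_open Om_bounded 1 (-1) (Hu i).1 (Hw i).1) (H0 i).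
  by congr weak_deriv; apply/funext => x; rewrite /G1; field.
exists G1; split=> //.
pose v x := (u1 x - w1 x) - (u0 x - w0 x); pose k i x := G1 i x - G0 i x.
have vk i : weak_deriv Om i v (k i).
  have := weak_deriv_comb Om_open Om_bounded 1 (-1) (HG1 i) (H0 i).
  by congr weak_deriv; apply/funext => x; rewrite /v /k; ring.
have Lv : L2 v by have [/(inL2P Om_open)] := vk ord0.
have LG1 i : L2 (G1 i) by have [_ /(inL2P Om_open)] := HG1 i.
have LG0 i : L2 (G0 i) by have [_ /(inL2P Om_open)] := H0 i.
have eu := neumann0_avg Om_open Om_bounded Nu1 Nu0 Hu vk.
have ew := neumann0_avg Om_open Om_bounded Nw1 Nw0 Hw vk.
have Iv u1' u0' g h : inH Om 2 u1' -> inH Om 2 u0' ->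
    weak_hess Om (fun x => (u1' x + u0' x) / 2) g h ->
    lap Om (fun x => (u1' x + u0' x) / 2) = (fun x => \sum_(i < 2) h i x) ->
    intble (fun x => ((\sum_(i < 2) h i x) * v x + \sum_(i < 2) g i x * k i x)%:E).
  move=> h1 h0 H lapE.
  have Lg i : L2 (g i) by have [[_ /(inL2P Om_open)]] := H i.
  have Lk i : L2 (k i) by exact: sqintB.
  have := integrableD mOm (integrable_mul mOm (lap_avg_sqint h1 h0) Lv)
    (integrable_sum mOm (index_enum 'I_2) (P := xpredT)
      (fun i _ => integrable_mul mOm (Lg i) (Lk i))).
  by apply: eq_integrable => // x _; rewrite lapE /= sumEFin -EFinD.
have Iu := Iv _ _ _ _ Nu1.1 Nu0.1 Hu lapu; have Iw := Iv _ _ _ _ Nw1.1 Nw0.1 Hw lapw.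
have P i : intble (EFin \o (fun x => (gu i x - gw i x) * k i x)) /\
    integ Om (fun x => (gu i x - gw i x) * k i x) =
    (integ Om (fun x => G1 i x ^+ 2) - integ Om (fun x => G0 i x ^+ 2)) / 2.
  by apply: sqnorm_polarization => // x; rewrite /G1; field.
have ILv : intble (EFin \o (fun x => (lap Om (fun y => (u1 y + u0 y) / 2) x
    - lap Om (fun y => (w1 y + w0 y) / 2) x) * v x)).
  by apply: integrable_mul => //; exact: sqintB.
have e : integ Om (fun x => (lap Om (fun y => (u1 y + u0 y) / 2) x
    - lap Om (fun y => (w1 y + w0 y) / 2) x) * v x
    + ((gu ord0 x - gw ord0 x) * k ord0 x
       + (gu ord_max x - gw ord_max x) * k ord_max x)) = 0.
  rewrite -[RHS](subrr (0 : R)) -[X in _ = X - _]eu -[X in _ = _ - X]ew.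
  rewrite /integ -RintegralB//; apply: eq_Rintegral => x _.
  rewrite lapu lapw !big_ord_recr !big_ord0 /= !add0r.
  rewrite (_ : widen_ord _ _ = ord0); last exact/val_inj.
  by ring.
have [I0 p0] := P ord0; have [I1 p1] := P ord_max.
have I01 : intble (EFin \o (fun x => (gu ord0 x - gw ord0 x) * k ord0 x
    + (gu ord_max x - gw ord_max x) * k ord_max x)).
  by have := integrableD mOm I0 I1; apply: eq_integrable.
move: e; rewrite /integ RintegralD// RintegralD// -!/(integ Om _) p0 p1.
rewrite !big_ord_recr !big_ord0 /= !add0r.
rewrite (_ : widen_ord _ _ = ord0); last exact/val_inj.
rewrite -/(integ Om (fun x => G1 ord0 x ^+ 2)) -/(integ Om (fun x => G1 ord_max x ^+ 2)).
rewrite -/(integ Om (fun x => G0 ord0 x ^+ 2)) -/(integ Om (fun x => G0 ord_max x ^+ 2)).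
move: (integ _ _) (integ _ _) (integ _ _) (integ _ _) (integ _ _) => *; lra.
Qed.

End NeumannEnergy.

(** * The error estimate *)

Section ErrorEstimate.
Context {R : realType} (Om : set (R * R)) (T gam1 gam2 eta C0 : R).
Variables phi phit : R -> R * R -> R.
Variable start : R -> @state R -> @state R.
Hypothesis Om_open : open Om.
Hypothesis Om_bounded : bounded_set Om.
Hypothesis Om_sobolev : sobolev_inequalities Om.
Hypothesis T_gt0 : 0 < T.
Hypothesis gam1_gt0 : 0 < gam1.
Hypothesis gam2_gt0 : 0 < gam2.
Hypothesis C0_large : forall s, 0 < radicand gam2 C0 s.
Hypothesis phi_exact : exact_solution Om T gam1 gam2 eta phi phit.
Hypothesis phi_regular : regularity Om T phi phit.

Local Notation L2 := (sqint (@leb2 R) (Om : set (mR2 R))).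
Local Notation I2 u := (integ Om (fun x => u x ^+ 2)).

Let mOm : measurable (Om : set (mR2 R)).
Proof. exact: open_measurable_plane. Qed.

Let muOm : (@leb2 R Om < +oo)%E.
Proof. exact: bounded_finite_measure_plane. Qed.

Lemma normL2_le u (c : R) : L2 u -> (normLp Om 2%:E u <= c%:E)%E -> I2 u <= c ^+ 2.
Proof.
move=> Lu uc; rewrite -lee_fin -(normL2_sqr Om_open Lu) EFin_expe !expe2.
by apply: lee_pmul => //; exact: Lnorm_ge0.
Qed.

Lemma normL2_sqint u (c : R) :
  measurable_fun (Om : set (mR2 R)) (u : mR2 R -> mR R) ->
  (normLp Om 2%:E u <= c%:E)%E -> L2 u.
Proof.
move=> mu_ uc; apply/(inL2P Om_open); split=> //.
exact: le_lt_trans uc (ltry _).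
Qed.

Lemma exact_measurable t : 0 <= t <= T ->
  measurable_fun (Om : set (mR2 R)) (phi t : mR2 R -> mR R).
Proof.
by apply: measurable_time_slice => //; have [] := phi_W1oo phi_regular.
Qed.

Lemma exact_Loo : exists2 B : R, 0 <= B &
  forall t, 0 <= t <= T -> ae_in Om (fun x => `|phi t x| <= B).
Proof.
apply: (exact_ae_bounded Om_open T_gt0 (exact_time_deriv phi_exact)
  (phit_Loo phi_regular) Om_sobolev).
by have [] := exact_neumann phi_exact (t := T); rewrite ?T_gt0 ?lexx.
Qed.

Lemma exact_sqint t : 0 <= t <= T -> L2 (phi t).
Proof.
have [B _ phiB] := exact_Loo => t0T.
exact: (ae_bounded_sqint mOm muOm (exact_measurable t0T) (phiB _ t0T)).
Qed.

Lemma exact_q_Loo : exists2 Q : R, 0 <= Q & forall t, 0 <= t <= T ->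
  ae_in Om (fun x => `|qfun gam2 C0 (phi t x)| <= Q).
Proof.
have [B _ phiB] := exact_Loo.
have [Q Q0 qQ] := qfun_bounded gam2_gt0 C0_large B; exists Q => // t t0T.
by apply: ae_in_impl (phiB _ t0T) => x _; exact: qQ.
Qed.

Lemma exact_q_measurable t : 0 <= t <= T -> measurable_fun (Om : set (mR2 R))
  ((fun x => qfun gam2 C0 (phi t x)) : mR2 R -> mR R).
Proof.
move=> t0T; apply: (measurableT_comp (f := qfun gam2 C0)).
  exact: continuous_measurable_fun (continuous_qfun C0_large).
exact: exact_measurable.
Qed.

Lemma exact_q_sqint t : 0 <= t <= T -> L2 (fun x => qfun gam2 C0 (phi t x)).
Proof.
have [Q _ qQ] := exact_q_Loo => t0T.
exact: (ae_bounded_sqint mOm muOm (exact_q_measurable t0T) (qQ _ t0T)).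
Qed.

Lemma measurable_gbar (W : nat -> @state R) n :
  measurable_fun (Om : set (mR2 R)) (sphi (W n) : mR2 R -> mR R) ->
  measurable_fun (Om : set (mR2 R)) (sphi (W n.-1) : mR2 R -> mR R) ->
  measurable_fun (Om : set (mR2 R)) (gbar gam2 C0 W n : mR2 R -> mR R).
Proof.
move=> m1 m0.
have mg (u : R * R -> R) : measurable_fun (Om : set (mR2 R)) (u : mR2 R -> mR R) ->
    measurable_fun (Om : set (mR2 R)) ((fun x => gfun gam2 C0 (u x)) : mR2 R -> mR R).
  move=> mu_; apply: (measurableT_comp (f := gfun gam2 C0)) => //.
  exact: continuous_measurable_fun (continuous_gfun C0_large).
by apply: measurable_funB; apply: measurable_funM => //; exact: mg.
Qed.

(** One run of the scheme.  The constants M, Q, Lg, K, and later Ks, are fixed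
    before the number N of steps and the numerical solution U, so that the
    final constant, built from them and the data of the model, is uniform in
    N and U. *)
Section OneRun.
Variables (M Q Lg K : R).
Hypothesis phi_lipschitz : forall s t, 0 <= s -> s <= t -> t <= T ->
  ae_in Om (fun x => `|phi t x - phi s x| <= M * (t - s)).
Hypothesis phi_q_bound : forall t, 0 <= t <= T ->
  ae_in Om (fun x => `|qfun gam2 C0 (phi t x)| <= Q).
Hypothesis g_lipschitz : forall x y,
  `|gfun gam2 C0 x - gfun gam2 C0 y| <= Lg * `|x - y|.

Variables (N : nat) (U : nat -> @state R).
Hypothesis N_gt0 : (0 < N)%N.
Hypothesis run : peq_solution Om T gam1 gam2 eta C0 start (phi 0) N U.

Local Notation tau := (T / N%:R).
Local Notation V := (fun k : nat => exact_state Om gam2 eta C0 phi (k%:R * tau)).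
Local Notation e_phi := (fun n x => phi (n%:R * tau) x - sphi (U n) x).
Local Notation e_q := (fun n x => qfun gam2 C0 (phi (n%:R * tau) x) - sq (U n) x).
Local Notation e_zeta := (fun n => zeta Om eta phi (n%:R * tau) - szeta (U n)).

Hypothesis truncation : forall n, (1 <= n < N)%N ->
  [/\ (normLp Om 2%:E (res_phi Om gam1 gam2 eta C0 tau V n) <= (K * tau ^+ 2)%:E)%E,
      (normLp Om 2%:E (res_q gam2 C0 V n) <= (tau * (K * tau ^+ 2))%:E)%E
    & (normLp Om 2%:E (cst (res_zeta Om eta V n)) <= (tau * (K * tau ^+ 2))%:E)%E].

Lemma tau_gt0 : 0 < tau.
Proof. by rewrite divr_gt0// ltr0n. Qed.

Lemma grid_le n : (n <= N)%N -> 0 <= n%:R * tau <= T.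
Proof.
move=> nN; rewrite mulr_ge0 ?(ltW tau_gt0)//= mulrCA ger_pMr//.
by rewrite ler_pdivrMr ?ltr0n// mul1r ler_nat.
Qed.

Lemma exact_neumann_grid n : (1 <= n <= N)%N -> neumann0 Om (phi (n%:R * tau)).
Proof.
move=> /andP[n1 nN]; apply: (exact_neumann phi_exact).
by have /andP[_ ->] := grid_le nN; rewrite mulr_gt0 ?tau_gt0// ltr0n.
Qed.

(** The scheme starts from exact data, so that the local error of the starting
    procedure is the whole error at the first level. *)
Lemma init_exact : U 0%N = exact_state Om gam2 eta C0 phi 0.
Proof.
by rewrite (peq_init run) /init_state /exact_state /zeta subrr mulr0.
Qed.

Lemma run_phi_sqint n : (n <= N)%N -> L2 (sphi (U n)).
Proof.
case: n => [_|n nN].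
  by rewrite init_exact; apply: exact_sqint; rewrite lexx ltW.
by have [+ _] := peq_neumann run (n := n.+1) nN; move=> /(inH2_hess Om_open)[].
Qed.

Lemma run_q_sqint n : (n <= N)%N -> L2 (sq (U n)).
Proof.
case: n => [_|n nN].
  by rewrite init_exact; apply: exact_q_sqint; rewrite lexx ltW.
by apply/(inL2P Om_open)/(peq_sq run).
Qed.

Lemma e_phi_sqint n : (n <= N)%N -> L2 (e_phi n).
Proof.
by move=> nN; apply: sqintB => //; [apply: exact_sqint; exact: grid_le | exact: run_phi_sqint].
Qed.

Lemma e_q_sqint n : (n <= N)%N -> L2 (e_q n).
Proof.
by move=> nN; apply: sqintB => //; [apply: exact_q_sqint; exact: grid_le | exact: run_q_sqint].
Qed.

Let mfun u := measurable_fun (Om : set (mR2 R)) (u : mR2 R -> mR R).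

Let exact_phi_mfun n : (n <= N)%N -> mfun (phi (n%:R * tau)).
Proof. by move=> nN; apply: exact_measurable; exact: grid_le. Qed.

Let exact_q_mfun n : (n <= N)%N -> mfun (fun x => qfun gam2 C0 (phi (n%:R * tau) x)).
Proof. by move=> nN; apply: exact_q_measurable; exact: grid_le. Qed.

Let gbar_exact_mfun n : (1 <= n < N)%N -> mfun (gbar gam2 C0 V n).
Proof.
move=> /andP[n1 nN]; apply: measurable_gbar; apply: exact_phi_mfun.
  exact: ltnW.
exact: leq_trans (leq_pred _) (ltnW nN).
Qed.

Lemma res_phi_exact_sqint n : (1 <= n < N)%N ->
  L2 (res_phi Om gam1 gam2 eta C0 tau V n).
Proof.
move=> nN; have [n1 nN'] := andP nN.
have [+ _ _] := truncation nN; apply: normL2_sqint.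
have H1 : inH Om 2 (phi (n.+1%:R * tau)) by exact: (@exact_neumann_grid n.+1 nN').1.
have H0 : inH Om 2 (phi (n%:R * tau)).
  by apply: (exact_neumann_grid _).1; rewrite n1 (ltnW nN').
have [mlap _] := lap_avg_sqint Om_open Om_bounded H1 H0.
have mg := gbar_exact_mfun nN.
have m1 := exact_phi_mfun nN'; have m0 := exact_phi_mfun (ltnW nN').
have q1 := exact_q_mfun nN'; have q0 := exact_q_mfun (ltnW nN').
have mM u v : mfun u -> mfun v -> mfun (fun x => u x * v x) by exact: measurable_funM.
have mD u v : mfun u -> mfun v -> mfun (fun x => u x + v x) by exact: measurable_funD.
have mB u v : mfun u -> mfun v -> mfun (fun x => u x - v x) by exact: measurable_funB.
have mC (c : R) : mfun (fun=> c) by exact: measurable_cst.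
exact: (mD _ _ (mD _ _ (mD _ _
  (mB _ _ (mM _ _ (mB _ _ m1 m0) (mC _)) (mM _ _ (mC _) mlap))
  (mM _ _ (mC _) (mM _ _ (mD _ _ m1 m0) (mC _))))
  (mM _ _ (mM _ _ (mC _) (mM _ _ (mD _ _ q1 q0) (mC _))) mg)) (mC _)).
Qed.

Lemma res_q_exact_sqint n : (1 <= n < N)%N -> L2 (res_q gam2 C0 V n).
Proof.
move=> nN; have [n1 nN'] := andP nN.
have [_ + _] := truncation nN; apply: normL2_sqint.
have mg := gbar_exact_mfun nN.
have m1 := exact_phi_mfun nN'; have m0 := exact_phi_mfun (ltnW nN').
have q1 := exact_q_mfun nN'; have q0 := exact_q_mfun (ltnW nN').
apply: measurable_funB; first exact: measurable_funB.
by apply: measurable_funM => //; exact: measurable_funB.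
Qed.

Local Notation lap_err := (fun n x =>
  lap Om (fun y => (phi (n.+1%:R * tau) y + phi (n%:R * tau) y) / 2) x
  - lap Om (fun y => (sphi (U n.+1) y + sphi (U n) y) / 2) x).
Local Notation step_const := ((2 * Q ^+ 2 + 4 * T * M ^+ 2) * (9 / 2 * Lg ^+ 2)).

Lemma error_equation_energy n : (1 <= n < N)%N -> ae_in Om (fun x =>
  - gam1 * (lap_err n x * (e_phi n.+1 x - e_phi n x))
    + gam2 * (e_phi n.+1 x ^+ 2 - e_phi n x ^+ 2)
    + (e_q n.+1 x ^+ 2 - e_q n x ^+ 2)
    + Num.sqrt eta * ((e_zeta n.+1 + e_zeta n) / 2) * (e_phi n.+1 x - e_phi n x) <=
  tau * res_phi Om gam1 gam2 eta C0 tau V n x ^+ 2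
    + tau * step_const * (e_phi n x ^+ 2 + e_phi n.-1 x ^+ 2)
    + tau / (4 * T) * (e_q n x ^+ 2 + e_q n.+1 x ^+ 2)
    + 4 * T / tau * res_q gam2 C0 V n x ^+ 2).
Proof.
move=> nN; have [n1 nN'] := andP nN.
have [res1 res2 _] := peq_step run nN.
have g1 := @grid_le n.+1 nN'; have g0 := grid_le (ltnW nN').
have dt : n.+1%:R * tau - n%:R * tau = tau.
  by rewrite -mulrBl -natrB ?leqnSn// subSnn mul1r.
have lip : ae_in Om (fun x => `|phi (n.+1%:R * tau) x - phi (n%:R * tau) x| <= M * tau).
  have := @phi_lipschitz (n%:R * tau) (n.+1%:R * tau) (andP g0).1.
  rewrite dt; apply; last exact: (andP g1).2.
  by rewrite -subr_ge0 dt ltW// tau_gt0.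
apply: ae_in_impl (ae_in_and (ae_in_and res1 res2)
  (ae_in_and lip (ae_in_and (phi_q_bound g1) (phi_q_bound g0)))).
move=> x _ [[r1 r2] [dV [qV1 qV0]]].
pose qV1x := qfun gam2 C0 (phi (n.+1%:R * tau) x).
pose qV0x := qfun gam2 C0 (phi (n%:R * tau) x).
apply: (@pointwise_energy R gam1 gam2 (Num.sqrt eta) tau T Q M Lg (e_phi n x)
  (e_phi n.+1 x) (e_phi n.-1 x) (e_q n x) (e_q n.+1 x) (e_zeta n) (e_zeta n.+1)
  (lap_err n x) (gbar gam2 C0 V n x - gbar gam2 C0 U n x) (gbar gam2 C0 U n x)
  ((qV1x + qV0x) / 2) (phi (n.+1%:R * tau) x - phi (n%:R * tau) x)) => //.
- exact: tau_gt0.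
- rewrite normrM (@ger0_norm _ 2^-1)// ler_pdivrMr//.
  apply: le_trans (ler_normD _ _) _; move: qV1 qV0; rewrite -/qV1x -/qV0x; lra.
- rewrite /gbar /=.
  set A := gfun _ _ (phi (n%:R * tau) x); set B := gfun _ _ (sphi (U n) x).
  set A' := gfun _ _ (phi (n.-1%:R * tau) x); set B' := gfun _ _ (sphi (U n.-1) x).
  have -> : 3 / 2 * A - 1 / 2 * A' - (3 / 2 * B - 1 / 2 * B') =
    3 / 2 * (A - B) - 1 / 2 * (A' - B') by ring.
  apply: le_trans (ler_normB _ _) _; rewrite !normrM.
  rewrite (@ger0_norm _ 3)// (@ger0_norm _ 2^-1)// (@ger0_norm _ 1)//.
  have h := g_lipschitz (phi (n%:R * tau) x) (sphi (U n) x).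
  have h' := g_lipschitz (phi (n.-1%:R * tau) x) (sphi (U n.-1) x).
  rewrite -/A -/B in h; rewrite -/A' -/B' in h'; lra.
- rewrite -[RHS]subr0 -r1 /res_phi /= -/qV1x -/qV0x.
  have tN0 : T / N%:R != 0 by rewrite gt_eqF// tau_gt0.
  field; rewrite ?gt_eqF ?ltr0n//.
- by rewrite -[RHS]subr0 -r2 /res_q /= -/qV1x -/qV0x; ring.
Qed.

Lemma normL2_cst (c : R) :
  (normLp Om 2%:E (cst c) ^+ 2 = (c ^+ 2 * fine (@leb2 R Om))%:E)%E.
Proof.
by rewrite (normL2_sqr Om_open (sqint_cst mOm muOm c)) /integ -(Rintegral_cst (@leb2 R) mOm).
Qed.

Local Notation energy := (fun n (G : 'I_2 -> R * R -> R) =>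
  error_energy gam1 gam2 (\sum_(i < 2) I2 (G i)) (I2 (e_phi n)) (I2 (e_q n)) (e_zeta n)).
Local Notation vol := (fine (@leb2 R Om)).

Lemma I2_ge0 u : 0 <= I2 u.
Proof. by apply: Rintegral_ge0 => x _; exact: sqr_ge0. Qed.

(* The truncation error of the scalar equation is measured in the norm of
   constant functions on Om, which controls the scalar itself only if Om has
   positive measure. *)
Hypothesis vol_gt0 : 0 < vol.

(** One time step, for the weak gradient G1 constructed from G0 by the Neumann
    conditions. *)
Lemma energy_step n (G0 : 'I_2 -> R * R -> R) : (1 <= n < N)%N ->
  (forall i, weak_deriv Om i (e_phi n) (G0 i)) ->
  exists2 G1 : 'I_2 -> R * R -> R,
    forall i, weak_deriv Om i (e_phi n.+1) (G1 i) &
    energy n.+1 G1 - energy n G0 <=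
      tau / (4 * T) * (energy n.+1 G1 + energy n G0)
      + tau * (step_const / gam2) * (gam2 * I2 (e_phi n) + gam2 * I2 (e_phi n.-1))
      + (K ^+ 2 + 4 * T * K ^+ 2 + T * (K ^+ 2 / vol)) * tau ^+ 5.
Proof.
move=> nN HG0; have [n1 nN'] := andP nN.
have nN1 : (n <= N)%N by exact: ltnW.
have nNm : (n.-1 <= N)%N by exact: leq_trans (leq_pred _) _.
have n01 : (1 <= n <= N)%N by rewrite n1.
have NV1 := @exact_neumann_grid n.+1 nN'; have NV0 := exact_neumann_grid n01.
have NU1 := peq_neumann run (n := n.+1) nN'; have NU0 := peq_neumann run n01.
have [G1 [HG1 J]] := neumann_laplacian_energy Om_open Om_bounded NV1 NV0 NU1 NU0 HG0.
exists G1 => //.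
have LL : L2 (lap_err n).
  by apply: sqintB => //; [exact: (lap_avg_sqint Om_open Om_bounded NV1.1 NV0.1)
                          |exact: (lap_avg_sqint Om_open Om_bounded NU1.1 NU0.1)].
have [t1 t2 t3] := truncation nN; have [_ _ r3] := peq_step run nN.
have sumI2 (G : 'I_2 -> R * R -> R) : 0 <= \sum_(i < 2) I2 (G i).
  by apply: sumr_ge0 => i _; exact: I2_ge0.
apply: (energy_balance (s := Num.sqrt eta) (R3 := res_zeta Om eta V n)
  (S := integ Om (fun x => e_phi n.+1 x - e_phi n x))
  gam1_gt0 gam2_gt0 tau_gt0 T_gt0 (sumI2 _) (sumI2 _) (I2_ge0 _) (I2_ge0 _) J _
  (normL2_le (res_phi_exact_sqint nN) t1) (normL2_le (res_q_exact_sqint nN) t2)).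
- rewrite -[RHS]subr0 -r3 /res_zeta /=.
  have I u : L2 u -> (@leb2 R).-integrable (Om : set (mR2 R)) (EFin \o u).
    exact: integrable_sqint.
  have LV1 := exact_sqint (@grid_le n.+1 nN'); have LV0 := exact_sqint (grid_le nN1).
  have LU1 := @run_phi_sqint n.+1 nN'; have LU0 := run_phi_sqint nN1.
  rewrite /integ (RintegralB mOm (I _ (@e_phi_sqint n.+1 nN')) (I _ (e_phi_sqint nN1))).
  rewrite (RintegralB mOm (I _ LV1) (I _ LU1)) (RintegralB mOm (I _ LV0) (I _ LU0)).
  rewrite (RintegralB mOm (I _ LV1) (I _ LV0)) (RintegralB mOm (I _ LU1) (I _ LU0)).
  by ring.
- rewrite -(ler_pM2r vol_gt0).
  have -> : K ^+ 2 / vol * tau ^+ 6 * vol = (tau * (K * tau ^+ 2)) ^+ 2.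
    by field; rewrite !gt_eqF// ltr0n.
  rewrite -lee_fin -normL2_cst EFin_expe !expe2.
  by apply: lee_pmul => //; exact: Lnorm_ge0.
- exact: (integrated_energy Om_open Om_bounded (e_phi_sqint nN1) (@e_phi_sqint n.+1 nN')
    (e_phi_sqint nNm) (e_q_sqint nN1) (@e_q_sqint n.+1 nN') LL
    (res_phi_exact_sqint nN) (res_q_exact_sqint nN) (error_equation_energy nN)).
Qed.

Lemma weak_deriv0 i : weak_deriv Om i (cst 0) (cst 0).
Proof.
have E f : integ Om (fun x => cst 0 x * f x) = 0.
  rewrite (_ : (fun x => _) = cst 0); last by apply/funext => x; rewrite mul0r.
  exact: etrans (Rintegral_cst (@leb2 R) mOm 0) (mul0r _).
have L0 := sqint_cst mOm muOm (0 : R).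
by split; try exact/(inL2P Om_open); move=> psi _; rewrite !E oppr0.
Qed.

Let I20 (u : R * R -> R) : (forall x, u x = 0) -> I2 u = 0.
Proof.
move=> u0; rewrite (_ : (fun x => _) = cst 0).
  exact: etrans (Rintegral_cst (@leb2 R) mOm 0) (mul0r _).
by apply/funext => x; rewrite u0 expr0n.
Qed.

Lemma initial_e_phi x : e_phi 0%N x = 0.
Proof. by rewrite /= init_exact /= mul0r subrr. Qed.

Lemma initial_e_q x : e_q 0%N x = 0.
Proof. by rewrite /= init_exact /= mul0r subrr. Qed.

Lemma initial_e_zeta : e_zeta 0%N = 0.
Proof. by rewrite /= init_exact /= mul0r subrr. Qed.

Lemma initial_energy : energy 0%N (fun=> cst 0) = 0.
Proof.
rewrite /error_energy (I20 initial_e_phi) (I20 initial_e_q) initial_e_zeta.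
by rewrite big1 => [|i _]; [rewrite expr0n !mulr0 mul0r !addr0 | exact: I20].
Qed.

Variable Ks : R.
Hypothesis start_error : forall t dt, 0 <= t -> 0 < dt -> t + dt <= T ->
  (sqerr Om (exact_state Om gam2 eta C0 phi (t + dt))
     (start dt (exact_state Om gam2 eta C0 phi t)) <= ((Ks * dt ^+ 2) ^+ 2)%:E)%E.

Local Notation start_const :=
  ((gam1 + gam2) * (Ks ^+ 2 + 1) + Ks ^+ 2 + Ks ^+ 2 / vol).

Let start_energy_le (A D P Z : R) : 0 <= A -> 0 <= D ->
  A + D <= (Ks * tau ^+ 2) ^+ 2 + tau ^+ 4 -> P <= (Ks * tau ^+ 2) ^+ 2 ->
  Z ^+ 2 <= (Ks * tau ^+ 2) ^+ 2 / vol ->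
  error_energy gam1 gam2 D A P Z <= start_const * tau ^+ 4.
Proof.
move=> A0 D0 AD PK ZK.
have k1 : (gam1 + gam2) * (A + D) <= (gam1 + gam2) * ((Ks * tau ^+ 2) ^+ 2 + tau ^+ 4).
  by rewrite ler_wpM2l// addr_ge0// ltW.
have k2 := mulr_ge0 (ltW gam1_gt0) A0; have k3 := mulr_ge0 (ltW gam2_gt0) D0.
have k4 := mulr_ge0 (ltW gam1_gt0) D0; have k5 := sqr_ge0 Z.
have -> : start_const * tau ^+ 4 = (gam1 + gam2) * ((Ks * tau ^+ 2) ^+ 2 + tau ^+ 4)
  + (Ks * tau ^+ 2) ^+ 2 + (Ks * tau ^+ 2) ^+ 2 / vol by ring.
rewrite /error_energy; lra.
Qed.

(** The norm of the starting error is an infimum over weak gradients, which need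
    not be attained; the additional tau^4 pays for an almost minimal one and is
    of the order of the estimate. *)
Lemma first_step_energy : exists2 G : 'I_2 -> R * R -> R,
  forall i, weak_deriv Om i (e_phi 1%N) (G i) & energy 1%N G <= start_const * tau ^+ 4.
Proof.
have := start_error (lexx 0) tau_gt0.
rewrite -init_exact -(peq_first run).
have -> : 0 + tau = 1%N%:R * tau by rewrite add0r mul1r.
have /andP[_ tauT] := @grid_le 1%N N_gt0; move=> /(_ tauT).
rewrite /sqerr; set e := sqnormH _ _ _; set p := (normLp _ _ _ ^+ 2)%E.
set z := (normLp _ _ _ ^+ 2)%E => le.
have e0 : (0 <= e)%E by exact: sqnormH_ge0.
have p0 : (0 <= p)%E by rewrite /p expe2 mule_ge0// Lnorm_ge0.
have z0 : (0 <= z)%E by rewrite /z expe2 mule_ge0// Lnorm_ge0.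
have ele := le_trans (leeDl _ p0) (le_trans (leeDl _ z0) le).
have ple := le_trans (leeDr _ e0) (le_trans (leeDl _ z0) le).
have zle := le_trans (leeDr _ (adde_ge0 e0 p0)) le.
have Le := @e_phi_sqint 1%N N_gt0; have Lq := @e_q_sqint 1%N N_gt0.
have t4 : 0 < tau ^+ 4 by rewrite exprn_gt0// tau_gt0.
have [G HG Gle] := sqnormH1_approx Om_open Le t4 ele.
exists G => //.
have {}ple : I2 (fun x => qfun gam2 C0 (phi (1%N%:R * tau) x) - sq (U 1%N) x) <= (Ks * tau ^+ 2) ^+ 2.
  by rewrite -lee_fin -(normL2_sqr Om_open Lq).
have {}zle : (zeta Om eta phi (1%N%:R * tau) - szeta (U 1%N)) ^+ 2 <= (Ks * tau ^+ 2) ^+ 2 / vol.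
  by rewrite ler_pdivlMr// -lee_fin -normL2_cst.
have A0 := I2_ge0 (fun x => phi (1%N%:R * tau) x - sphi (U 1%N) x).
have D0 : 0 <= \sum_(i < 2) I2 (G i) by apply: sumr_ge0 => i _; exact: I2_ge0.
exact: start_energy_le A0 D0 Gle ple zle.
Qed.

Local Notation growth := (1 / T + 4 * (step_const / gam2)).
Local Notation source := (K ^+ 2 + 4 * T * K ^+ 2 + T * (K ^+ 2 / vol)).
Local Notation bound := (fun n : nat => (1 + growth * tau) ^+ n *
  (start_const * tau ^+ 4 + n%:R * (2 * source * tau ^+ 5))).

Let start_const_ge0 : 0 <= start_const.
Proof.
have k2 := sqr_ge0 Ks; have v0 := ltW vol_gt0.
have g12 : 0 <= gam1 + gam2 by rewrite addr_ge0 ?ltW.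
apply: addr_ge0; last exact: divr_ge0.
by apply: addr_ge0 => //; apply: mulr_ge0 => //; exact: addr_ge0.
Qed.

Let source_ge0 : 0 <= source.
Proof.
have k2 := sqr_ge0 K; have v0 := ltW vol_gt0; have T0 := ltW T_gt0.
apply: addr_ge0; last by apply: mulr_ge0 => //; exact: divr_ge0.
by apply: addr_ge0 => //; apply: mulr_ge0 => //; exact: mulr_ge0.
Qed.

Let step_const_ge0 : 0 <= step_const / gam2.
Proof.
have T0 := ltW T_gt0; apply: divr_ge0; last exact: ltW.
apply: mulr_ge0; last by rewrite mulr_ge0// sqr_ge0.
by apply: addr_ge0; apply: mulr_ge0; rewrite ?sqr_ge0// mulr_ge0.
Qed.

Let growth_ge0 : 0 <= growth.
Proof. by apply: addr_ge0; [apply: divr_ge0 => //; exact: ltW | exact: mulr_ge0]. Qed.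

Let energy_ge_phi (D A P Z : R) : 0 <= D -> 0 <= P ->
  gam2 * A <= error_energy gam1 gam2 D A P Z.
Proof.
move=> D0 P0; have h1 := mulr_ge0 (ltW gam1_gt0) D0; have h3 := sqr_ge0 Z.
rewrite /error_energy; lra.
Qed.

Let bound_step (b A r : R) n : 1 <= b -> 0 <= r ->
  b * (b ^+ n.+1 * (A + n.+1%:R * (2 * r))) + 2 * r <=
  b ^+ n.+2 * (A + n.+2%:R * (2 * r)).
Proof.
move=> b1 r0; have -> : b ^+ n.+2 * (A + n.+2%:R * (2 * r)) =
    b * (b ^+ n.+1 * (A + n.+1%:R * (2 * r))) + b ^+ n.+2 * (2 * r).
  by rewrite -[n.+2%:R]natr1 [b ^+ n.+2]exprS; ring.
by rewrite lerD2l ler_peMl ?exprn_ege1// mulr_ge0.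
Qed.

(** The weak gradients are produced along the induction.  The bound on the
    previous level is part of the claim since gbar extrapolates from two
    levels; at n = 0 the truncated predecessor is harmless because the initial
    error vanishes. *)
Lemma energy_bound n : (n <= N)%N -> exists2 G : 'I_2 -> R * R -> R,
  forall i, weak_deriv Om i (e_phi n) (G i) &
  energy n G <= bound n /\ gam2 * I2 (e_phi n.-1) <= bound n.
Proof.
have t0 := ltW tau_gt0.
have b0 : 1 <= 1 + growth * tau by rewrite lerDl mulr_ge0.
have s4 : 0 <= start_const * tau ^+ 4 by exact: mulr_ge0 (exprn_ge0 4 t0).
have src0 : 0 <= source * tau ^+ 5 by exact: mulr_ge0 (exprn_ge0 5 t0).
have src20 : 0 <= 2 * source * tau ^+ 5 by rewrite -mulrA mulr_ge0.
have bd n' : 0 <= bound n'.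
  apply: mulr_ge0; first exact: exprn_ge0 (le_trans ler01 b0).
  by apply: addr_ge0 => //; exact: mulr_ge0.
have tauT : tau <= T by have /andP[_] := @grid_le 1%N N_gt0; rewrite mul1r.
have e0 : gam2 * I2 (e_phi 0%N) = 0.
  by rewrite (I20 initial_e_phi) mulr0.
elim: n => [|[|n] IH] nN.
- exists (fun=> cst 0).
    move=> i; rewrite (_ : (fun x => _) = cst 0); first exact: weak_deriv0.
    by apply/funext => x; exact: initial_e_phi.
  by rewrite initial_energy e0.
- have [G HG Gle] := first_step_energy; exists G => //; rewrite e0; split => //.
  apply: le_trans Gle _; rewrite expr1 (mul1r (2 * _ * _)).
  apply: (le_trans _ (ler_peMl (addr_ge0 s4 src20) b0)).
  by rewrite lerDl.
- have [G0 HG0 [E0 A0]] := IH (ltnW nN).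
  have [G1 HG1 step] := energy_step (n := n.+1) nN HG0.
  have D0 : 0 <= \sum_(i < 2) I2 (G0 i) by apply: sumr_ge0 => i _; exact: I2_ge0.
  have A1 : gam2 * I2 (e_phi n.+1) <= energy n.+1 G0.
    exact: energy_ge_phi D0 (I2_ge0 (e_q n.+1)).
  have grow : (1 + growth * tau) * bound n.+1 + 2 * (source * tau ^+ 5) <= bound n.+2.
    by rewrite -!(mulrA 2); exact: bound_step.
  exists G1 => //; split; last first.
    apply: le_trans (le_trans A1 E0) _; apply: (le_trans _ grow).
    apply: (le_trans (ler_peMl (bd n.+1) b0)).
    by rewrite lerDl mulr_ge0// mulr_ge0.
  apply: (le_trans _ grow).
  exact: (implicit_step_growth T_gt0 tau_gt0 tauT step_const_ge0 src0 (bd n.+1)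
    E0 (le_trans A1 E0) A0 step).
Qed.

Local Notation total_error := (fun n =>
  (sqnormH Om 1 (e_phi n) + normLp Om 2%:E (e_q n) ^+ 2
   + normLp Om 2%:E (cst (e_zeta n)) ^+ 2)%E).

Let energy_control (D A P Z : R) : 0 <= D -> 0 <= A -> 0 <= P ->
  A + D + P + Z ^+ 2 * vol <=
  (2 / gam1 + 1 / gam2 + 1 + 2 * vol) * error_energy gam1 gam2 D A P Z.
Proof.
move=> D0 A0 P0; have Z0 : 0 <= Z ^+ 2 / 2 by rewrite divr_ge0// sqr_ge0.
have gD : 0 <= gam1 / 2 * D by rewrite mulr_ge0// divr_ge0// ltW.
have gA : 0 <= gam2 * A by rewrite mulr_ge0// ltW.
have EE : error_energy gam1 gam2 D A P Z = gam1 / 2 * D + gam2 * A + P + Z ^+ 2 / 2 by [].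
have cD : 0 <= 2 / gam1 by rewrite divr_ge0// ltW.
have cA : 0 <= 1 / gam2 by rewrite divr_ge0// ltW.
have cV : 0 <= 2 * vol by rewrite mulr_ge0// ltW.
have hD : D <= 2 / gam1 * error_energy gam1 gam2 D A P Z.
  rewrite [leLHS](_ : D = 2 / gam1 * (gam1 / 2 * D)); last by field; rewrite gt_eqF.
  by rewrite ler_wpM2l// EE; lra.
have hA : A <= 1 / gam2 * error_energy gam1 gam2 D A P Z.
  rewrite [leLHS](_ : A = 1 / gam2 * (gam2 * A)); last by field; rewrite gt_eqF.
  by rewrite ler_wpM2l// EE; lra.
have hZ : Z ^+ 2 * vol <= 2 * vol * error_energy gam1 gam2 D A P Z.
  have -> : Z ^+ 2 * vol = 2 * vol * (Z ^+ 2 / 2) by field.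
  by rewrite ler_wpM2l// EE; lra.
have hP : P <= 1 * error_energy gam1 gam2 D A P Z by rewrite mul1r EE; lra.
rewrite !mulrDl; lra.
Qed.

Lemma run_error n : (n <= N)%N ->
  (total_error n <= ((2 / gam1 + 1 / gam2 + 1 + 2 * vol) *
    (expR (growth * T) * (start_const + 2 * source * T)) * tau ^+ 4)%:E)%E.
Proof.
move=> nN; have [G HG [Ele _]] := energy_bound nN.
have NT : N%:R * tau = T by rewrite mulrCA divff ?mulr1// pnatr_eq0 -lt0n.
have src2 : 0 <= 2 * source by rewrite mulr_ge0.
have := gronwall_bound growth_ge0 start_const_ge0 src2 (ltW tau_gt0) nN NT.
move=> /(le_trans Ele) {}Ele.
have D0 : 0 <= \sum_(i < 2) I2 (G i) by apply: sumr_ge0 => i _; exact: I2_ge0.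
apply: (@le_trans _ _ (I2 (e_phi n) + \sum_(i < 2) I2 (G i) + I2 (e_q n)
    + e_zeta n ^+ 2 * vol)%:E).
  rewrite !EFinD -normL2_cst -(normL2_sqr Om_open (e_q_sqint nN)) -EFinD.
  by rewrite leeD// leeD//; exact: (sqnormH1_le Om_open HG).
rewrite lee_fin -(mulrA _ _ (tau ^+ 4)).
apply: le_trans (energy_control _ D0 (I2_ge0 _) (I2_ge0 _)) _.
rewrite ler_wpM2l// !addr_ge0 ?divr_ge0 ?mulr_ge0 ?(ltW gam1_gt0) ?(ltW gam2_gt0) ?(ltW vol_gt0)//.
Qed.

Lemma e_phi_weak_gradient n : (n <= N)%N ->
  exists G : 'I_2 -> R * R -> R, forall i, weak_deriv Om i (e_phi n) (G i).
Proof.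
case: n => [_|n nN].
  exists (fun=> cst 0) => i; rewrite (_ : (fun x => _) = cst 0).
    exact: weak_deriv0.
  by apply/funext => x; exact: initial_e_phi.
have [_ [g [h H]]] := inH2_hess Om_open (@exact_neumann_grid n.+1 nN).1.
have [_ [g' [h' H']]] := inH2_hess Om_open (peq_neumann run (n := n.+1) nN).1.
exists (fun i x => 1 * g i x + (-1) * g' i x) => i.
have := weak_deriv_comb Om_open Om_bounded 1 (-1) (H i).1 (H' i).1.
by congr weak_deriv; apply/funext => x; ring.
Qed.

(** In the degenerate case of a null set, which includes the empty set, all
    norms vanish; only the existence of a weak gradient has to be checked, as an
    infimum over the empty set would be +oo. *)
Lemma null_volume_error n : vol = 0 -> (n <= N)%N -> (total_error n <= 0)%E.
Proof.
move=> vol0 nN; have [G HG] := e_phi_weak_gradient nN.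
have mu0 : @leb2 R Om = 0%E.
  by rewrite -(@fineK _ (@leb2 R Om)) ?vol0// ge0_fin_numE.
have I0 u : L2 u -> I2 u = 0.
  move=> [mu_ _]; rewrite /integ /Rintegral null_set_integral//.
  exact/measurable_EFinP/measurable_funX.
have LG i : L2 (G i) by have [_ /(inL2P Om_open)] := HG i.
rewrite normL2_cst vol0 mulr0 (normL2_sqr Om_open (e_q_sqint nN)) (I0 _ (e_q_sqint nN)).
rewrite !adde0; apply: le_trans (sqnormH1_le Om_open HG) _.
by rewrite (I0 _ (e_phi_sqint nN)) big1 ?addr0// => i _; exact: I0.
Qed.

End OneRun.

End ErrorEstimate.

Theorem theorem4p1 (R : realType) (Om : set (R * R))
  (T gam1 gam2 eta C0 : R)
  (phi phit : R -> R * R -> R)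
  (start : R -> state -> state)
  (Om_open : open Om) (Om_connected : connected Om)
  (Om_bounded : bounded_set Om) (Om_boundary : C1_boundary Om)
  (Om_sobolev : sobolev_inequalities Om)
  (T_gt0 : 0 < T)
  (gam1_gt0 : 0 < gam1) (gam2_gt0 : 0 < gam2) (eta_gt0 : 0 < eta)
  (C0_large : forall s, 0 < radicand gam2 C0 s)
  (phi_exact : exact_solution Om T gam1 gam2 eta phi phit)
  (phi_regular : regularity Om T phi phit)
  (phi_truncation : second_order_truncation Om T gam1 gam2 eta C0 phi)
  (start_first_order : first_order_scheme Om T gam2 eta C0 phi start) :
  exists C : R, forall (N : nat) (U : nat -> state), (0 < N)%N ->
    peq_solution Om T gam1 gam2 eta C0 start (phi 0) N U ->
    forall n : nat, (n <= N)%N ->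
    let dt := T / N%:R in
    let e_phi := fun x => phi (n%:R * dt) x - sphi (U n) x in
    let e_q := fun x => qfun gam2 C0 (phi (n%:R * dt) x) - sq (U n) x in
    let e_zeta := zeta Om eta phi (n%:R * dt) - szeta (U n) in
    (sqnormH Om 1 e_phi + normLp Om 2%:E e_q ^+ 2
       + normLp Om 2%:E (cst e_zeta) ^+ 2 <= (C * dt ^+ 4)%:E)%E.
Proof.
have [M _ lip] := exact_lipschitz_in_time Om_open
  (exact_time_deriv phi_exact) (phit_Loo phi_regular).
have [Q _ qQ] := exact_q_Loo Om_open Om_sobolev T_gt0 gam2_gt0 C0_large
  phi_exact phi_regular.
have [Lg _ gL] := gfun_lipschitz gam2_gt0 C0_large.
have [K trunc] := phi_truncation; have [Ks startK] := start_first_order.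
have : 0 <= fine (@leb2 R Om) by rewrite fine_ge0.
rewrite le_eqVlt => /orP[/eqP/esym vol0|vol_gt0].
  exists 0 => N U N_gt0 run n nN; cbv zeta; rewrite mul0r.
  exact: (null_volume_error Om_open Om_bounded Om_sobolev T_gt0 gam2_gt0
    C0_large phi_exact phi_regular N_gt0 run vol0 nN).
eexists => N U N_gt0 run n nN; cbv zeta.
exact: (run_error Om_open Om_bounded Om_sobolev T_gt0 gam1_gt0 gam2_gt0
  C0_large phi_exact phi_regular lip qQ gL N_gt0 run (trunc N) vol_gt0 startK nN).
Qed.
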